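(* $\mathcal{C}_{\mathbf{H}_r}=\mathcal{C}_{\mathbf{H}_r^<}=\mathcal{C}_{\mathbf{H}_{r,k}}=\mathcal{C}_{\mathbf{H}_{r,k}^<}$ whenever $2\leq r<k<\omega$.
   Context: Hypergraphs. For $2\le r<\omega$, $\mathbf{H}_r$ is the class of all finite structures in the language with one $r$-ary relation symbol $R$ in which $R$ is irreflexive ($R(\overline x)$ implies $x_i\ne x_j$ for all $i<j<r$) and symmetric (closed under all permutations of the coordinates). For $k>r$, $\mathbf{H}_{r,k}\subseteq\mathbf{H}_r$ is the subclass of those hypergraphs that exclude the complete $r$-hypergraph on $k$ vertices, i.e. in which among any $k$ distinct vertices some $r$ of them do not form a hyperedge. All of these are algebraically trivial Fraïssé classes. For such a class $\mathbf{K}$, its generic order-expansion $\mathbf{K}^<$ is the class of all finite structures obtained from a member of $\mathbf{K}$ by adding a linear ordering $<$ of its universe (with $<$ a new binary relation symbol); it is again an algebraically trivial Fraïssé class. Theories and the ordering $\trianglelefteq$. $\mathbb{T}$ is the class of all complete first-order (possibly many-sorted) theories with infinite models that eliminate imaginaries; $\mathcal{L}_T$ is the language of $T$. A theory $T$ that may not eliminate imaginaries is freely identified with $T^{\mathrm{eq}}$. Fix a countably infinite set $A$. For $T\in\mathbb{T}$, $\mathbf{F}(T)$ is the set of injections $f:B\to M$, where $B\subset A$ is finite and $M$ is the universe of some model $\mathcal{M}\models T$, such that all $f(a)$, $a\in B$, lie in one sort, and for every $B_0\subsetneq B$ the type $\mathrm{tp}(f[B]/f[B_0])$ is non-algebraic.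 A sequence $\boldsymbol\phi=(\phi_0,\dots,\phi_{N-1})$ of $\mathcal{L}_T$-formulas is always finite and all free variables range over one common sort (the sort of $\boldsymbol\phi$); if $\phi_i=\phi_i(x_0,\dots,x_{n_i-1})$, then $\mathcal{L}_{\boldsymbol\phi}$ is the one-sorted language with signature $\{R_0^{(n_0)},\dots,R_{N-1}^{(n_{N-1})}\}$ (the languages of two sequences that coordinate-wise have the same arities are identified). $\mathbf{F}_{\boldsymbol\phi}(T)$ is the set of $f\in\mathbf{F}(T)$ with values in the sort of $\boldsymbol\phi$; for such $f:B\to M$, $B_{\boldsymbol\phi}(f)$ is the $\mathcal{L}_{\boldsymbol\phi}$-structure with universe $B$ and $R_i=\{\overline a\in B^{n_i}:\mathcal{M}\models\phi_i(f\overline a)\}$. $\mathrm{Age}_{\boldsymbol\phi}(T)=\{B_{\boldsymbol\phi}(f):f\in\mathbf{F}_{\boldsymbol\phi}(T)\}$ up to isomorphism. For $T_1,T_2\in\mathbb{T}$, $T_1\trianglelefteq T_2$ means: for every finite sequence $\boldsymbol\phi^1$ of $\mathcal{L}_{T_1}$-formulas there is a sequence $\boldsymbol\phi^2$ of $\mathcal{L}_{T_2}$-formulas, coordinate-wise of the same arities, with $\mathrm{Age}_{\boldsymbol\phi^1}(T_1)\subseteq\mathrm{Age}_{\boldsymbol\phi^2}(T_2)$. Fraïssé classes. A Fraïssé class is a class of finite structures in a one-sorted finite relational language having the hereditary, joint-embedding and amalgamation properties. $T_{\mathbf{K}}$ is the complete theory of the generic model (Fraïssé limit) of $\mathbf{K}$.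 $\mathbf{K}$ is algebraically trivial if $\mathrm{acl}^{\mathcal{M}}(X)=X$ for all $\mathcal{M}\models T_{\mathbf{K}}$ and $X\subseteq M$. For such $\mathbf{K}$, $\mathcal{C}_{\mathbf{K}}=\{T\in\mathbb{T}:T_{\mathbf{K}}\trianglelefteq T\}$. *)

(* Defs.v *)
From mathcomp Require Import all_boot perm finmap.
From mathcomp Require Import boolp classical_sets cardinality.
Set Implicit Arguments.
Unset Strict Implicit.
Unset Printing Implicit Defensive.

Local Open Scope classical_set_scope.

(* Many-sorted first-order logic.  Formulas are well scoped: [formula Gamma] is
   the type of formulas whose free variables are the elements of [X], where
   [x : X] ranges over the sort [Gamma x].  A quantifier adds the variable
   [None] to the context. *)

Record language := Language {
  srt : Type;
  fun_sym : Type;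
  fun_ar : fun_sym -> nat;
  fun_dom : forall f : fun_sym, 'I_(fun_ar f) -> srt;
  fun_cod : fun_sym -> srt;
  rel_sym : Type;
  rel_ar : rel_sym -> nat;
  rel_dom : forall R : rel_sym, 'I_(rel_ar R) -> srt }.

Definition ctx_cons (S X : Type) (s : S) (Gamma : X -> S) (o : option X) : S :=
  match o with Some x => Gamma x | None => s end.

Definition ctx_cat (S X Y : Type) (Gamma : X -> S) (Delta : Y -> S)
    (z : X + Y) : S :=
  match z with inl x => Gamma x | inr y => Delta y end.

Inductive term (L : language) (X : Type) (Gamma : X -> srt L) :
    srt L -> Type :=
| Var (x : X) : term Gamma (Gamma x)
| App (f : fun_sym L) (t : forall i, term Gamma (fun_dom (f := f) i)) :
    term Gamma (fun_cod f).

Inductive formula (L : language) (X : Type) (Gamma : X -> srt L) : Type :=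
| Bot
| Equal (s : srt L) (t u : term Gamma s)
| Rel (R : rel_sym L) (t : forall i, term Gamma (rel_dom (R := R) i))
| Imp (phi psi : formula Gamma)
| All (s : srt L) (phi : formula (ctx_cons s Gamma)).

Definition sentence (L : language) := formula (of_void (srt L)).

Record structure (L : language) := Structure {
  carrier :> srt L -> Type;
  fun_int : forall f : fun_sym L,
    (forall i, carrier (fun_dom (f := f) i)) -> carrier (fun_cod f);
  rel_int : forall R : rel_sym L,
    (forall i, carrier (rel_dom (R := R) i)) -> Prop }.

Section Semantics.
Variables (L : language) (M : structure L).

Definition env (X : Type) (Gamma : X -> srt L) := forall x, M (Gamma x).

Definition env_cons (X : Type) (Gamma : X -> srt L) (s : srt L) (a : M s)
    (v : env Gamma) : env (ctx_cons s Gamma) :=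
  fun o => match o with Some x => v x | None => a end.

Definition env_cat (X Y : Type) (Gamma : X -> srt L) (Delta : Y -> srt L)
    (v : env Gamma) (w : env Delta) : env (ctx_cat Gamma Delta) :=
  fun z => match z with inl x => v x | inr y => w y end.

Definition env_nil : env (of_void (srt L)) := fun x => match x with end.

Fixpoint eval (X : Type) (Gamma : X -> srt L) (v : env Gamma) (s : srt L)
    (t : term Gamma s) : M s :=
  match t with
  | Var x => v x
  | App f u => fun_int (fun i => eval v (u i))
  end.

Fixpoint sat (X : Type) (Gamma : X -> srt L) (phi : formula Gamma) :
    env Gamma -> Prop :=
  match phi with
  | Bot => fun _ => False
  | Equal s t u => fun v => eval v t = eval v u
  | Rel R t => fun v => rel_int (fun i => eval v (t i))
  | Imp phi psi => fun v => sat phi v -> sat psi v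
  | All s phi => fun v => forall a : M s, sat phi (env_cons a v)
  end.

Definition holds (phi : sentence L) : Prop := sat phi env_nil.

Definition tp (X Y : Type) (Gamma : X -> srt L) (Delta : Y -> srt L)
    (a : env Gamma) (c : env Delta) : set (formula (ctx_cat Gamma Delta)) :=
  [set phi | sat phi (env_cat a c)].

(* [p] is a type in the variables [X] over the parameters [c]. *)
Definition algebraic (X Y : Type) (Gamma : X -> srt L) (Delta : Y -> srt L)
    (c : env Delta) (p : set (formula (ctx_cat Gamma Delta))) : Prop :=
  exists2 phi, p phi & finite_set [set g : env Gamma | sat phi (env_cat g c)].

(* The relation defined by a formula in two copies of the variables [X]. *)
Definition def_rel (X : Type) (Gamma : X -> srt L)
    (E : formula (ctx_cat Gamma Gamma)) (a b : env Gamma) : Prop :=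
  sat E (env_cat a b).

End Semantics.

Record theory := Theory { lang : language; axioms : set (sentence lang) }.

Arguments axioms : clear implicits.

(* As usual, sorts of models are non-empty. *)
Definition models (T : theory) (M : structure (lang T)) : Prop :=
  (forall s, inhabited (M s)) /\ (forall phi, axioms T phi -> holds M phi).

Arguments models : clear implicits.

Definition complete (T : theory) : Prop :=
  (exists M, models T M) /\
  (forall phi : sentence (lang T),
     (forall M, models T M -> holds M phi) \/
     (forall M, models T M -> ~ holds M phi)).

Definition has_infinite_models (T : theory) : Prop :=
  exists2 M, models T M & infinite_set [set: {s : srt (lang T) & M s}].

(* Every class of a 0-definable equivalence relation on a finite product of
   sorts is defined by some formula [phi(x, b)] for a unique real tuple [b]. *)
Definition eliminates_imaginaries (T : theory) : Prop :=
  forall M, models T M ->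
  forall (n : nat) (Gamma : 'I_n -> srt (lang T))
         (E : formula (ctx_cat Gamma Gamma)),
  RelationClasses.Equivalence (def_rel (M := M) E) ->
  forall a : env M Gamma,
  exists (m : nat) (Delta : 'I_m -> srt (lang T))
         (phi : formula (ctx_cat Gamma Delta)),
  exists! b : env M Delta,
  forall x : env M Gamma, sat phi (env_cat x b) <-> def_rel E a x.

Definition TT (T : theory) : Prop :=
  [/\ complete T, has_infinite_models T & eliminates_imaginaries T].

Section Teq.
Variable T : theory.

Record imaginary := Imaginary {
  im_ar : nat;
  im_ctx : 'I_im_ar -> srt (lang T);
  im_rel : formula (ctx_cat im_ctx im_ctx);
  im_equiv : forall M, models T M ->
    RelationClasses.Equivalence (def_rel (M := M) im_rel) }.

(* A new sort for each imaginary [E], with a symbol for the projection to it. *)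
Definition lang_eq : language :=
  @Language
    (srt (lang T) + imaginary)
    (fun_sym (lang T) + imaginary)
    (fun f => match f with inl g => fun_ar g | inr E => im_ar E end)
    (fun f => match f with
              | inl g => fun i => inl (fun_dom i)
              | inr E => fun i => inl (im_ctx i)
              end)
    (fun f => match f with inl g => inl (fun_cod g) | inr E => inr E end)
    (rel_sym (lang T))
    (@rel_ar (lang T))
    (fun R i => inl (rel_dom i)).

Variable M : structure (lang T).

Definition im_class (E : imaginary) (a : env M (im_ctx (i := E))) :
    set (env M (im_ctx (i := E))) :=
  [set b | def_rel (im_rel E) a b].

Definition eq_carrier (s : srt lang_eq) : Type :=
  match s with
  | inl s0 => M s0
  | inr E => {C : set (env M (im_ctx (i := E))) | exists a, C = im_class a}
  end.

Definition struct_eq : structure lang_eq :=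
  @Structure lang_eq eq_carrier
    (fun f => match f return
         (forall i, eq_carrier (@fun_dom lang_eq f i)) ->
         eq_carrier (@fun_cod lang_eq f) with
       | inl g => fun a => fun_int (f := g) a
       | inr E => fun a =>
           exist _ (im_class (E := E) a) (ex_intro _ a erefl)
       end)
    (@rel_int (lang T) M).

End Teq.

(* T^eq, as the common theory of the structures M^eq for M |= T *)
Definition theory_eq (T : theory) : theory :=
  @Theory (lang_eq T)
    [set phi | forall M, models T M -> holds (struct_eq M) phi].

Record signature := Signature { sym : finType; ar : sym -> nat }.

Record rstruct (S : signature) := RStruct {
  univ :> Type;
  interp : forall R : sym S, ('I_(ar R) -> univ) -> Prop }.

Definition embedding (S : signature) (A B : rstruct S) (h : A -> B) : Prop :=
  injective h /\
  (forall (R : sym S) (v : 'I_(ar R) -> A), interp v <-> interp (h \o v)).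

Definition isomorphism (S : signature) (A B : rstruct S) (h : A -> B) : Prop :=
  bijective h /\ embedding h.

Definition finite_rstruct (S : signature) (A : rstruct S) : Prop :=
  finite_set [set: A].

(* The fixed countably infinite set is [nat]; [s] is the common sort of the
   values of [f]. *)
Definition FF (T : theory) (s : srt (lang T)) (M : structure (lang T))
    (B : {fset nat}) (f : B -> M s) : Prop :=
  [/\ models T M, injective f &
      forall (B0 : {fset nat}) (hB0 : (B0 `<` B)%fset),
        let f0 := f \o fincl (fproper_sub hB0) in
        ~ algebraic (f0 : env M (fun _ : B0 => s))
            (tp (f : env M (fun _ : B => s)) f0)].

Definition formula_seq (L : language) (s : srt L) (N : nat) (n : 'I_N -> nat) :=
  forall i : 'I_N, formula (fun _ : 'I_(n i) => s).

Definition Bphi (L : language) (s : srt L) (N : nat) (n : 'I_N -> nat)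
    (phi : formula_seq s n) (M : structure L) (B : {fset nat}) (f : B -> M s) :
    rstruct (Signature n) :=
  @RStruct (Signature n) B (fun i a => sat (phi i) (f \o a)).

Definition Age (T : theory) (s : srt (lang T)) (N : nat) (n : 'I_N -> nat)
    (phi : formula_seq s n) (A : rstruct (Signature n)) : Prop :=
  exists (M : structure (lang T)) (B : {fset nat}) (f : B -> M s)
         (h : A -> Bphi phi f), FF f /\ isomorphism h.

Definition trile (T1 T2 : theory) : Prop :=
  forall (N : nat) (n : 'I_N -> nat)
         (s1 : srt (lang T1)) (phi1 : formula_seq s1 n),
  exists (s2 : srt (lang T2)) (phi2 : formula_seq s2 n),
    forall A : rstruct (Signature n), Age phi1 A -> Age phi2 A.

(* [M] is the Fraisse limit of [K]. *)
Definition generic_model (S : signature) (K : rstruct S -> Prop)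
    (M : rstruct S) : Prop :=
  [/\ countable [set: M],
      forall A : rstruct S, finite_rstruct A ->
        (K A <-> exists h : A -> M, embedding h) &
      forall (A : rstruct S) (h1 h2 : A -> M), finite_rstruct A ->
        embedding h1 -> embedding h2 ->
        exists2 g : M -> M, isomorphism g & g \o h1 = h2].

Definition lang_of (S : signature) : language :=
  @Language unit void (fun f => match f with end) (fun f => match f with end)
    (fun f => match f with end) (sym S) (@ar S) (fun _ _ => tt).

Definition struct_of (S : signature) (A : rstruct S) : structure (lang_of S) :=
  @Structure (lang_of S) (fun _ => univ A)
    (fun f => match f with end) (fun R v => interp v).

(* The generic model is unique up to isomorphism. *)
Definition generic_theory (S : signature) (K : rstruct S -> Prop) : theory :=
  @Theory (lang_of S)
    [set phi | forall M, generic_model K M -> holds (struct_of M) phi].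

(* Since the theory of the generic model need not eliminate imaginaries, it is
   replaced by its T^eq. *)
Definition CC (S : signature) (K : rstruct S -> Prop) (T : theory) :
    Prop :=
  TT T /\ trile (theory_eq (generic_theory K)) T.

Definition hyper_sig (r : nat) : signature := Signature (fun _ : unit => r).

Definition edge (r : nat) (A : rstruct (hyper_sig r)) (v : 'I_r -> A) : Prop :=
  interp (r := A) (R := tt) v.

Definition HH (r : nat) (A : rstruct (hyper_sig r)) : Prop :=
  [/\ finite_rstruct A,
      forall v : 'I_r -> A, edge v -> injective v &
      forall (v : 'I_r -> A) (p : 'S_r), edge v -> edge (v \o p)].

Definition HHex (r k : nat) (A : rstruct (hyper_sig r)) : Prop :=
  HH A /\
  forall w : 'I_k -> A, injective w ->
    exists2 e : 'I_r -> 'I_k, injective e & ~ edge (w \o e).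

Arguments HH : clear implicits.
Arguments HHex : clear implicits.

(* The new symbol [None] is interpreted as a strict linear order. *)
Definition order_sig (S : signature) : signature :=
  @Signature (option (sym S))
    (fun R => match R with Some R0 => ar R0 | None => 2 end).

Definition order_reduct (S : signature) (A : rstruct (order_sig S)) :
    rstruct S :=
  @RStruct S A (fun R v => interp (r := A) (R := Some R) v).

Definition order_rel (S : signature) (A : rstruct (order_sig S)) (a b : A) :
    Prop :=
  interp (r := A) (R := None) (fun i : 'I_2 => if i == ord0 then a else b).

Definition order_exp (S : signature) (K : rstruct S -> Prop)
    (A : rstruct (order_sig S)) : Prop :=
  [/\ K (order_reduct A),
      RelationClasses.StrictOrder (order_rel (A := A)) &
      forall a b : A, [\/ order_rel a b, a = b | order_rel b a]].

(* Main.v *)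
Require Import Defs.
From mathcomp Require Import all_boot perm finmap.
From mathcomp Require Import boolp classical_sets cardinality.

(** The four classes are equivalent because each of their theories can be coded
    in each of the others: with T_K read as its T^eq, [trile] holds between any
    two of them in both directions, and as [trile] is transitive the classes
    [CC] agree.  One construction ([coding_trile]) gives all these relations.

    Let K1 be any class in a signature whose arities lie between 1 and r, and let
    K2 be one of the four classes, with generic model G.  Every r-partite
    r-hypergraph occurs in K2: two vertices of the same part lie in no common
    edge, so more than r vertices cannot be complete ([partite_HHex]), and a
    linear order may be added at will.  Code a vertex d of a finite structure
    of K1 by points (d, R, j) of G, one for each symbol R and position j < r, and
    code R(d_0, ..., d_(n-1)) by the edge with the points (d_j, R, j), the first
    entry serving again at the positions from n on.  All relations between vertices, an
    ordering included, are then definable in G from the codes.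

    To obtain [trile], formulas about imaginary elements have to be coded too.
    Choose for each imaginary element a real tuple that represents it.  By a
    back-and-forth argument between arbitrary models ([sat_rep_similar]) the
    truth of a formula depends only on the quantifier-free pattern of these
    tuples; there are finitely many patterns, so the formula becomes definable
    from the codes of the tuples.  A sort of G^eq that consists of all tuples of
    the relevant length thus carries formulas with the required age.

    It remains to respect non-algebraicity.  If no element of a finite family is
    algebraic over the others, representatives can be chosen such that each tuple
    has an entry that belongs to no other tuple; it suffices to make the union
    of all the tuples as large as possible ([independent_representatives]).  The
    codes then inherit independence, since in G a point can be moved to
    infinitely many places without changing its pattern over finitely many
    other points.

    This last property, and the existence of G, come from a Fraisse construction
    on the natural numbers ([fraisse]) in which each one-point extension is
    realized by infinitely many new points.  It applies to classes in which
    one-point extensions can be amalgamated without identifying points; for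
    hypergraphs the free amalgam does, which creates no new complete
    subhypergraph because r >= 2 ([HHex_amalgamation]), and for their order
    expansions a cut is extended ([order_exp_amalgamation]). *)

Set Implicit Arguments.
Unset Strict Implicit.
Unset Printing Implicit Defensive.

Local Open Scope classical_set_scope.

(** * First-order definability *)

Section Expressible.
Variable L : language.

Fixpoint tsubst (X : Type) (Gamma : X -> srt L) (Y : Type) (Delta : Y -> srt L)
    (sigma : forall x, term Delta (Gamma x)) (s : srt L) (t : term Gamma s) :
    term Delta s :=
  match t with
  | Var x => sigma x
  | App f u => App (fun i => tsubst sigma (u i))
  end.

Lemma eval_tsubst (M : structure L) (X : Type) (Gamma : X -> srt L) (Y : Type)
    (Delta : Y -> srt L) (sigma : forall x, term Delta (Gamma x)) (s : srt L)
    (t : term Gamma s) (v : env M Delta) :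
  eval v (tsubst sigma t) = eval (fun x => eval v (sigma x)) t.
Proof.
elim: t => [x //|f u IH] /=; congr (fun_int _).
by apply: functional_extensionality_dep.
Qed.

(** Formulas are never written out below.  A relation given uniformly in all
    structures is shown to be first order by the closure lemmas that follow. *)
Definition expressible (X : Type) (Gamma : X -> srt L)
    (Q : forall M : structure L, env M Gamma -> Prop) : Prop :=
  exists phi : formula Gamma, forall M v, sat phi v <-> Q M v.

Lemma expressible_ext (X : Type) (Gamma : X -> srt L)
    (Q Q' : forall M : structure L, env M Gamma -> Prop) :
  (forall M v, Q M v <-> Q' M v) -> expressible Q -> expressible Q'.
Proof. by move=> h [phi hphi]; exists phi => M v; rewrite hphi. Qed.

(** Renaming the variables of a many-sorted formula by a function would require
    transporting along equations between sorts; substituting terms of the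
    right sorts does not. *)
Lemma expressible_subst (X : Type) (Gamma : X -> srt L) (Y : Type)
    (Delta : Y -> srt L) (sigma : forall x, term Delta (Gamma x))
    (Q : forall M : structure L, env M Gamma -> Prop) :
  expressible Q -> expressible (fun M v => Q M (fun x => eval v (sigma x))).
Proof.
case=> phi hphi.
suff [psi hpsi] :
    exists psi : formula Delta, forall M v,
      sat psi v <-> sat phi (fun x => eval (M := M) v (sigma x)).
  by exists psi => M v; rewrite hpsi hphi.
elim: phi Y Delta sigma {Q hphi}
  => {X Gamma} [X G|X G s t u|X G R t|X G p IHp q IHq|X G s p IHp] Y Delta sigma.
- by exists (Bot _).
- exists (Equal (tsubst sigma t) (tsubst sigma u)) => M v /=.
  by rewrite !eval_tsubst.
- exists (Rel (fun i => tsubst sigma (t i))) => M v /=.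
  rewrite (_ : (fun i => eval v (tsubst sigma (t i))) =
    (fun i => eval (fun x => eval v (sigma x)) (t i))) //.
  by apply: functional_extensionality_dep => i; rewrite eval_tsubst.
- have [p' hp] := IHp _ _ sigma; have [q' hq] := IHq _ _ sigma.
  by exists (Imp p' q') => M v /=; rewrite hp hq.
- pose tau (o : option X) : term (ctx_cons s Delta) (ctx_cons s G o) :=
    match o with
    | Some x => tsubst (fun y => Var (ctx_cons s Delta) (Some y)) (sigma x)
    | None => Var (ctx_cons s Delta) None
    end.
  have [p' hp] := IHp _ _ tau.
  exists (All p') => M v /=; split=> h a; have := h a; rewrite hp;
  rewrite (_ : (fun x => eval (env_cons a v) (tau x)) =
    env_cons a (fun x => eval v (sigma x))) //;
  by apply: functional_extensionality_dep => -[x|] //=; rewrite eval_tsubst.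
Qed.

Section Connectives.
Variables (X : Type) (Gamma : X -> srt L).
Implicit Types Q : forall M : structure L, env M Gamma -> Prop.

Lemma expressible_imp Q Q' :
  expressible Q -> expressible Q' -> expressible (fun M v => Q M v -> Q' M v).
Proof.
by case=> p hp [q hq]; exists (Imp p q) => M v /=; rewrite hp hq.
Qed.

Lemma expressible_const (P : Prop) :
  expressible (fun (M : structure L) (v : env M Gamma) => P).
Proof.
have [hP|hP] := pselect P; last by exists (Bot Gamma).
by exists (Imp (Bot Gamma) (Bot Gamma)) => M v /=; split.
Qed.

Lemma expressible_not Q :
  expressible Q -> expressible (fun M v => ~ Q M v).
Proof. by move=> h; apply: expressible_imp (expressible_const False). Qed.

Lemma expressible_and Q Q' :
  expressible Q -> expressible Q' -> expressible (fun M v => Q M v /\ Q' M v).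
Proof.
move=> h h'; apply: (expressible_ext _ (expressible_not
  (expressible_imp h (expressible_not h')))) => M v.
split; last by case=> ? ?; apply.
by move=> n; split; apply: contrapT => m; apply: n => a // /m.
Qed.

Lemma expressible_iff Q Q' :
  expressible Q -> expressible Q' -> expressible (fun M v => Q M v <-> Q' M v).
Proof. by move=> h h'; apply: expressible_and; apply: expressible_imp. Qed.

Lemma expressible_eq (s : srt L) (t u : term Gamma s) :
  expressible (fun M (v : env M Gamma) => eval v t = eval v u).
Proof. by exists (Equal t u). Qed.

Lemma expressible_rel (R : rel_sym L)
    (t : forall i, term Gamma (rel_dom (R := R) i)) :
  expressible (fun M (v : env M Gamma) => rel_int (fun i => eval v (t i))).
Proof. by exists (Rel t). Qed.

Lemma expressible_finall (T : finType)
    (Q : T -> forall M : structure L, env M Gamma -> Prop) :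
  (forall t, expressible (Q t)) -> expressible (fun M v => forall t, Q t M v).
Proof.
move=> h.
suff hs (ts : seq T) :
    expressible (fun M v => forall t, t \in ts -> Q t M v).
  apply: (expressible_ext _ (hs (enum T))) => M v.
  by split=> hQ t; [apply: hQ; rewrite mem_enum | move=> _; apply: hQ].
elim: ts => [|t ts IH].
  by apply: (expressible_ext _ (expressible_const True)) => M v; split.
apply: (expressible_ext _ (expressible_and (h t) IH)) => M v; split.
  by case=> ht hts u; rewrite inE => /orP[/eqP ->//|]; apply: hts.
by move=> hQ; split=> [|u hu]; apply: hQ; rewrite inE ?eqxx // hu orbT.
Qed.

Lemma expressible_finex (T : finType)
    (Q : T -> forall M : structure L, env M Gamma -> Prop) :
  (forall t, expressible (Q t)) -> expressible (fun M v => exists t, Q t M v).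
Proof.
move=> h; apply: (expressible_ext _ (expressible_not
  (expressible_finall (fun t => expressible_not (h t))))) => M v.
by split=> [/existsNP[t /contrapT ht]|[t ht] /(_ t)//]; exists t.
Qed.

(** The defining formula is the disjunction over the finitely many valuations
    of the atoms that [P] allows. *)
Lemma expressible_bool (T : finType)
    (At : T -> forall M : structure L, env M Gamma -> Prop)
    (P : {ffun T -> bool} -> Prop) :
  (forall t, expressible (At t)) ->
  expressible (fun M v => P [ffun t => `[< At t M v >]]).
Proof.
move=> h.
apply: (expressible_ext (Q := fun M v => exists b : {ffun T -> bool},
  P b /\ forall t, At t M v <-> b t)) => [M v|].
  split=> [[b [Pb hb]]|hP].
    rewrite (_ : [ffun t => _] = b) //; apply/ffunP => t; rewrite ffunE.
    by apply/asboolP/idP => /hb.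
  by exists [ffun t => `[< At t M v >]]; split=> // t; rewrite ffunE asboolE.
apply: expressible_finex => b; apply: expressible_and.
  exact: expressible_const.
apply: expressible_finall => t; apply: expressible_iff => //.
exact: expressible_const.
Qed.

Lemma expressible_all1 (s : srt L)
    (Q : forall M : structure L, env M (ctx_cons s Gamma) -> Prop) :
  expressible Q ->
  expressible (fun M v => forall a : M s, Q M (env_cons a v)).
Proof.
by case=> p hp; exists (All p) => M v; split=> h a; apply/hp/h.
Qed.

End Connectives.

Lemma expressible_all_ord (s : srt L) (n : nat) (X : Type) (Gamma : X -> srt L)
    (Q : forall M : structure L, env M (ctx_cat Gamma (fun _ : 'I_n => s)) -> Prop) :
  expressible Q ->
  expressible (fun M v => forall w : 'I_n -> M s,
    Q M (env_cat v (w : env M (fun _ => s)))).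
Proof.
elim: n X Gamma Q => [|n IH] X Gamma Q hQ.
  pose sigma (z : X + 'I_0) : term Gamma (ctx_cat Gamma (fun _ => s) z) :=
    match z with
    | inl x => Var Gamma x
    | inr i => False_rect _ (notF (valP i))
    end.
  apply: (expressible_ext _ (expressible_subst sigma hQ)) => M v.
  have E (w : 'I_0 -> M s) : (fun x => eval v (sigma x)) =
      env_cat v (w : env M (fun _ => s)).
    by apply: functional_extensionality_dep => -[x|[]].
  split=> [h w|h]; first by rewrite -E.
  by rewrite (E (fun i => False_rect _ (notF (valP i)))).
pose sigma (z : X + 'I_n.+1) :
    term (ctx_cat (ctx_cons s Gamma) (fun _ : 'I_n => s))
      (ctx_cat Gamma (fun _ => s) z) :=
  match z with
  | inl x => Var (ctx_cat (ctx_cons s Gamma) (fun _ : 'I_n => s)) (inl (Some x))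
  | inr i => match unlift ord0 i with
             | Some j => Var (ctx_cat (ctx_cons s Gamma) (fun _ => s)) (inr j)
             | None => Var (ctx_cat (ctx_cons s Gamma) (fun _ => s)) (inl None)
             end
  end.
have hall := expressible_all1 (IH _ _ _ (expressible_subst sigma hQ)).
apply: (expressible_ext _ hall) => M v /=.
have E (a : M s) (w : 'I_n -> M s) :
    (fun x => eval (env_cat (env_cons a v) (w : env M (fun _ => s))) (sigma x)) =
    env_cat v (fun i => if unlift ord0 i is Some j then w j else a).
  apply: functional_extensionality_dep => -[x|i] //=.
  by case: (unlift ord0 i).
split=> h => [w|a w]; last by rewrite E; apply: h.
have := h (w ord0) (fun j => w (lift ord0 j)); rewrite E.
rewrite (_ : (fun i => _) = w) //; apply: funext => i.
by case: unliftP => [j|] ->.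
Qed.

Lemma expressible_all (s : srt L) (Y : finType) (X : Type) (Gamma : X -> srt L)
    (Q : forall M : structure L, env M Gamma -> (Y -> M s) -> Prop) :
  expressible (Gamma := ctx_cat Gamma (fun _ : Y => s))
    (fun M v => Q M (fun x => v (inl x)) (fun y => v (inr y))) ->
  expressible (fun M v => forall w : Y -> M s, Q M v w).
Proof.
move=> hQ.
pose sigma (z : X + Y) : term (ctx_cat Gamma (fun _ : 'I_#|Y| => s))
      (ctx_cat Gamma (fun _ => s) z) :=
  match z with
  | inl x => Var (ctx_cat Gamma (fun _ : 'I_#|Y| => s)) (inl x)
  | inr y => Var (ctx_cat Gamma (fun _ : 'I_#|Y| => s)) (inr (enum_rank y))
  end.
apply: (expressible_ext _ (expressible_all_ord (expressible_subst sigma hQ))).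
move=> M v /=; split=> h w.
  have := h (fun i => w (enum_val i)).
  by rewrite (_ : (fun y => w _) = w) //; apply: funext => y; rewrite enum_rankK.
exact: h.
Qed.

Lemma expressible_ex (s : srt L) (Y : finType) (X : Type) (Gamma : X -> srt L)
    (Q : forall M : structure L, env M Gamma -> (Y -> M s) -> Prop) :
  expressible (Gamma := ctx_cat Gamma (fun _ : Y => s))
    (fun M v => Q M (fun x => v (inl x)) (fun y => v (inr y))) ->
  expressible (fun M v => exists w : Y -> M s, Q M v w).
Proof.
move=> hQ.
apply: (expressible_ext _ (expressible_not
  (@expressible_all s Y X Gamma (fun M v w => ~ Q M v w) (expressible_not hQ)))).
by move=> M v; split=> [/existsNP[w /contrapT hw]|[w hw] /(_ w)//]; exists w.
Qed.

End Expressible.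

(** * Patterns of tuples and generic models *)

Section Similar.
Variable S : signature.
Implicit Types M : structure (lang_of S).

Definition similar (X : Type) M M' (w : X -> M tt) (w' : X -> M' tt) : Prop :=
  (forall x y, w x = w y <-> w' x = w' y) /\
  (forall (R : sym S) (v : 'I_(ar R) -> X),
     rel_int (L := lang_of S) (R := R) (fun i => w (v i)) <->
     rel_int (L := lang_of S) (R := R) (fun i => w' (v i))).

Lemma similar_sym (X : Type) M M' (w : X -> M tt) (w' : X -> M' tt) :
  similar w w' -> similar w' w.
Proof. by case=> e h; split=> [x y|R v]; [rewrite e | rewrite h]. Qed.

Lemma similar_trans (X : Type) M M' M'' (w : X -> M tt) (w' : X -> M' tt)
    (w'' : X -> M'' tt) :
  similar w w' -> similar w' w'' -> similar w w''.
Proof.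
by case=> e h [e' h']; split=> [x y|R v]; [rewrite e e' | rewrite h h'].
Qed.

Lemma similar_comp (X Y : Type) M M' (w : X -> M tt) (w' : X -> M' tt)
    (h : Y -> X) :
  similar w w' -> similar (fun y => w (h y)) (fun y => w' (h y)).
Proof. by case=> e hR; split=> [x y|R v]; [exact: e|exact: hR]. Qed.

Lemma similar_reindex (X Y : Type) M M' (w : X -> M tt) (w' : X -> M' tt)
    (h : Y -> X) u u' :
  (forall y, u y = w (h y)) -> (forall y, u' y = w' (h y)) ->
  similar w w' -> similar u u'.
Proof. by move=> /funext -> /funext -> /(similar_comp h). Qed.

Section Diagram.
Variable X : finType.

Definition atom : finType := (X * X + {R : sym S & {ffun 'I_(ar R) -> X}})%type.

Definition atom_holds M (w : X -> M tt) (t : atom) : Prop :=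
  match t with
  | inl xy => w xy.1 = w xy.2
  | inr Rv => rel_int (L := lang_of S) (R := tag Rv) (fun i => w (tagged Rv i))
  end.

Definition diagram M (w : X -> M tt) : {ffun atom -> bool} :=
  [ffun t => `[< atom_holds w t >]].

Lemma diagramP M M' (w : X -> M tt) (w' : X -> M' tt) :
  diagram w = diagram w' <-> similar w w'.
Proof.
split=> [E|[e h]].
  have {}E t : atom_holds w t <-> atom_holds w' t.
    by move/ffunP/(_ t): E; rewrite !ffunE; apply: asbool_eq_equiv.
  split=> [x y|R v]; first exact: (E (inl (x, y))).
  have /= := E (inr (Tagged (fun R => {ffun 'I_(ar R) -> X}) (finfun v))).
  rewrite (_ : (fun i => w _) = (fun i => w (v i))); last first.
    by apply: funext => i; rewrite ffunE.
  rewrite (_ : (fun i => w' _) = (fun i => w' (v i))) //.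
  by apply: funext => i; rewrite ffunE.
apply/ffunP => -[[x y]|[R v]]; rewrite !ffunE; apply: asbool_equiv_eq.
  exact: e.
exact: (h R v).
Qed.

Lemma expressible_diagram (Y : Type) (Gamma : Y -> srt (lang_of S))
    (t : X -> term Gamma (tt : srt (lang_of S)))
    (P : {ffun atom -> bool} -> Prop) :
  expressible (fun M (v : env M Gamma) => P (diagram (fun x => eval v (t x)))).
Proof.
apply: (expressible_bool
  (At := fun a M (v : env M Gamma) => atom_holds (fun x => eval v (t x)) a)).
case=> [[x y]|[R u]] /=; first exact: expressible_eq.
exact: (@expressible_rel (lang_of S) Y Gamma R (fun i => t (u i))).
Qed.

End Diagram.
End Similar.

Definition ocons (X A : Type) (a : A) (w : X -> A) (o : option X) : A :=
  if o is Some x then w x else a.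

Section GenericModels.
Variables (S : signature) (K : rstruct S -> Prop).

Definition range_sub (X : Type) (H : rstruct S) (w : X -> H) : rstruct S :=
  @RStruct S {a : H | exists x, w x = a} (fun R v => interp (fun i => sval (v i))).

Lemma range_sub_finite (X : finType) (H : rstruct S) (w : X -> H) :
  finite_rstruct (range_sub w).
Proof.
pose f (x : X) : range_sub w := exist _ (w x) (ex_intro _ x erefl).
rewrite /finite_rstruct (_ : [set: _] = f @` [set: X]).
  exact/finite_image/finite_finset.
apply/seteqP; split=> // -[a [x E]] _; exists x => //.
by subst a; congr exist; exact: Prop_irrelevance.
Qed.

Lemma range_sub_embedding (X : Type) (H : rstruct S) (w : X -> H) :
  embedding (fun a : range_sub w => sval a).
Proof.
split=> // -[a ha] [b hb] /= E; subst b; congr exist; exact: Prop_irrelevance.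
Qed.

Lemma similar_range (X : Type) (H H' : rstruct S) (w : X -> H) (w' : X -> H') :
  similar (M := struct_of H) (M' := struct_of H') w w' ->
  exists2 h : range_sub w -> H', embedding h &
    forall x (hx : exists y, w y = w x), h (exist _ (w x) hx) = w' x.
Proof.
case=> e hR.
pose pre (a : range_sub w) : X := projT1 (cid (svalP a)).
have wpre a : w (pre a) = sval a by rewrite /pre; case: cid.
exists (fun a => w' (pre a)); last by move=> x hx; apply/e; rewrite wpre.
split=> [a b /e|R v].
  by rewrite !wpre => /(proj1 (range_sub_embedding w)).
have := hR R (fun i => pre (v i)); rewrite /= => <-.
by rewrite (_ : (fun i => w _) = (fun i => sval (v i))) //; apply: funext => i.
Qed.

(** Similar tuples enumerate isomorphic finite substructures, so homogeneity
    for embeddings of structures gives homogeneity for tuples. *)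
Lemma generic_homogeneous (H : rstruct S) (X : finType) (w w' : X -> H) :
  generic_model K H ->
  similar (M := struct_of H) (M' := struct_of H) w w' ->
  exists2 g : H -> H, isomorphism g & forall x, g (w x) = w' x.
Proof.
move=> [_ _ hom] /similar_range[h eh hE].
have [g ig E] := hom _ _ _ (range_sub_finite w) (range_sub_embedding w) eh.
by exists g => // x; rewrite -(hE x (ex_intro _ x erefl)) -E.
Qed.

(** Two generic models have the same finite substructures, hence realize the
    same patterns. *)
Lemma generic_realize (H H' : rstruct S) (X : finType) (w : X -> H) :
  generic_model K H -> generic_model K H' ->
  exists w' : X -> H', similar (M := struct_of H) (M' := struct_of H') w w'.
Proof.
move=> [_ age _] [_ age' _].
have fin := range_sub_finite w.
have [h [ih hR]] : exists h : range_sub w -> H', embedding h.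
  by apply/(age' _ fin)/(age _ fin); exists (fun a => sval a);
    exact: range_sub_embedding.
pose f (x : X) : range_sub w := exist _ (w x) (ex_intro _ x erefl).
exists (fun x => h (f x)); split=> [x y|R v]; last first.
  exact: (hR R (fun i => f (v i))).
split=> [E|/ih/(congr1 sval)//].
by congr h; apply: (proj1 (range_sub_embedding w)).
Qed.

(** Only the axioms, and not the non-empty universe that [models] also asks
    for: this is what the real part of a model of T^eq is shown to satisfy. *)
Definition satisfies_generic (M : structure (lang_of S)) : Prop :=
  forall sigma, axioms (generic_theory K) sigma -> holds M sigma.

Lemma satisfies_generic_expressible
    (Q : forall M : structure (lang_of S), env M (of_void _) -> Prop)
    (M : structure (lang_of S)) :
  expressible Q ->
  (forall H, generic_model K H -> Q (struct_of H) (@env_nil _ _)) ->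
  satisfies_generic M -> Q M (@env_nil _ _).
Proof.
by case=> sigma hs hQ /(_ sigma) hM; apply/hs/hM => H /hQ/hs.
Qed.

(** The pattern of [(a, w)] occurs in some generic model, since otherwise its
    absence would be an axiom.  By homogeneity each generic model then realizes
    this pattern over every tuple similar to [w], and this extension property
    is again first order. *)
Lemma similar_forth (M M' : structure (lang_of S)) (X : finType)
    (w : X -> M tt) (w' : X -> M' tt) :
  satisfies_generic M -> satisfies_generic M' -> similar w w' ->
  forall a, exists a', similar (ocons a w) (ocons a' w').
Proof.
move=> gM gM' sww a.
pose nilc : void -> srt (lang_of S) := of_void _.
have [H [gH [u hu]]] : exists H, generic_model K H /\
    exists u : option X -> H, diagram (M := struct_of H) u = diagram (ocons a w).
  apply: contrapT => no.
  pose Q (M0 : structure (lang_of S)) (v : env M0 nilc) :=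
    forall u : option X -> M0 tt, diagram u <> diagram (ocons a w).
  suff : Q M (@env_nil _ _) by move/(_ (ocons a w)).
  apply: satisfies_generic_expressible gM => [|H gH u hu]; last first.
    by apply: no; exists H; split=> //; exists u.
  apply: (expressible_all (s := tt : srt (lang_of S))).
  exact: (expressible_diagram
    (fun y : option X => Var (ctx_cat nilc (fun=> tt : srt (lang_of S))) (inr y))
    (fun d => d <> diagram (ocons a w))).
pose Q (M0 : structure (lang_of S)) (v : env M0 nilc) :=
  forall w0 : X -> M0 tt, diagram w0 = diagram w ->
    exists b : unit -> M0 tt, diagram (ocons (b tt) w0) = diagram (ocons a w).
suff /(_ w') [|b /esym/diagramP hb] : Q M' (@env_nil _ _).
- exact/esym/diagramP.
- by exists (b tt).
apply: satisfies_generic_expressible gM' => [|H' gH' w0 /diagramP hw0].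
  pose C := ctx_cat nilc (fun _ : X => tt : srt (lang_of S)).
  apply: (expressible_all (s := tt : srt (lang_of S))
    (Q := fun M0 v w0 => diagram w0 = diagram w -> exists b : unit -> M0 tt,
      diagram (ocons (b tt) w0) = diagram (ocons a w))).
  apply: expressible_imp.
    exact: (expressible_diagram (fun y : X => Var C (inr y))
      (fun d => d = diagram w)).
  apply: (expressible_ex (s := tt : srt (lang_of S)) (Gamma := C)
    (Q := fun M0 v b =>
      diagram (ocons (b tt) (fun y => v (inr y))) = diagram (ocons a w))).
  pose D := ctx_cat C (fun _ : unit => tt : srt (lang_of S)).
  pose t (o : option X) : term D (tt : srt (lang_of S)) :=
    if o is Some x then Var D (inl (inr x)) else Var D (inr tt).
  apply: expressible_ext (expressible_diagram t (fun d => d = diagram (ocons a w))).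
  move=> M0 v /=; rewrite (_ : (fun x => eval v (t x)) =
    ocons (v (inr tt)) (fun y => v (inl (inr y)))) //.
  by apply: funext => -[].
have [u' huu'] := generic_realize u gH gH'.
have hu' : similar (M := struct_of H') u' (ocons a w).
  by apply: similar_trans (similar_sym huu') _; apply/diagramP.
have [] := generic_homogeneous (w := fun x => u' (Some x)) (w' := w0) gH'.
  apply: similar_trans (similar_sym hw0).
  exact: (similar_comp Some hu').
move=> g [[ginv gK gK'] [_ gR]] gE; exists (fun=> g (u' None)); apply/diagramP.
apply: similar_trans hu'; rewrite (_ : ocons _ _ = (fun x => g (u' x))).
  split=> [x y|R v]; first by split=> [/(can_inj gK)|->].
  by rewrite /= (gR R (fun i => u' (v i))).
by apply: funext => -[x|] //=.
Qed.

Lemma similar_forth_tuple (M M' : structure (lang_of S)) (X : finType)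
    (w : X -> M tt) (w' : X -> M' tt) (n : nat) (u : 'I_n -> M tt) :
  satisfies_generic M -> satisfies_generic M' -> similar w w' ->
  exists u' : 'I_n -> M' tt,
    similar (fun z : X + 'I_n => match z with inl x => w x | inr i => u i end)
            (fun z => match z with inl x => w' x | inr i => u' i end).
Proof.
move=> gM gM' sww; elim: n u => [|n IH] u.
  exists (fun i : 'I_0 => False_rect (M' tt) (notF (valP i))).
  by apply: (similar_reindex (h := fun z : X + 'I_0 =>
    match z with inl x => x | inr i => False_rect _ (notF (valP i)) end) _ _ sww);
    case=> [|[]].
have [u' su] := IH (fun i => u (lift ord0 i)).
have [a' sa] := similar_forth gM gM' su (u ord0).
exists (fun i => if unlift ord0 i is Some j then u' j else a').
pose h (z : X + 'I_n.+1) : option (X + 'I_n) :=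
  match z with inl x => Some (inl x)
             | inr i => omap inr (unlift ord0 i) end.
by apply: (similar_reindex (h := h) _ _ sa) => -[x|i] //=; case: unliftP => [j E|E] //=; rewrite E.
Qed.

End GenericModels.

(** * Imaginary elements and their representatives *)

Section RealPart.
Variable T : theory.

Definition real_part (N : structure (lang_eq T)) : structure (lang T) :=
  @Structure (lang T) (fun s => N (inl s))
    (fun f => @fun_int (lang_eq T) N (inl f))
    (fun R => @rel_int (lang_eq T) N R).

Lemma sat_real_part_struct_eq (M : structure (lang T)) (X : Type)
    (Gamma : X -> srt (lang T)) (phi : formula Gamma) (v : env M Gamma) :
  sat (M := real_part (struct_eq M)) phi v <-> sat phi v.
Proof. by case: M v. Qed.

Fixpoint treal (X : Type) (Gamma : X -> srt (lang T)) (Y : Type)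
    (Delta : Y -> srt (lang_eq T))
    (sigma : forall x, term Delta (inl (Gamma x) : srt (lang_eq T)))
    (s : srt (lang T)) (t : term Gamma s) :
    term Delta (inl s : srt (lang_eq T)) :=
  match t with
  | Var x => sigma x
  | App f u => @App (lang_eq T) Y Delta (inl f) (fun i => treal sigma (u i))
  end.

Lemma eval_treal (N : structure (lang_eq T)) (X : Type)
    (Gamma : X -> srt (lang T)) (Y : Type) (Delta : Y -> srt (lang_eq T))
    (sigma : forall x, term Delta (inl (Gamma x) : srt (lang_eq T)))
    (s : srt (lang T)) (t : term Gamma s) (v : env N Delta) :
  eval v (treal sigma t) =
  eval (M := real_part N) (fun x => eval v (sigma x)) t.
Proof.
elim: t => [x //|f u IH] /=.
rewrite (_ : (fun i => eval v (treal sigma (u i))) =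
  (fun i => eval (M := real_part N) (fun x => eval v (sigma x)) (u i))) //.
by apply: functional_extensionality_dep.
Qed.

(** This embeds the formulas of [T] into those of T^eq, so that sentences true in
    all models of [T] pass to the real parts of models of T^eq. *)
Lemma expressible_real (X : Type) (Gamma : X -> srt (lang T)) (Y : Type)
    (Delta : Y -> srt (lang_eq T))
    (sigma : forall x, term Delta (inl (Gamma x) : srt (lang_eq T)))
    (phi : formula Gamma) :
  expressible (fun N (v : env N Delta) =>
    sat (M := real_part N) phi (fun x => eval v (sigma x))).
Proof.
elim: phi Y Delta sigma
  => {X Gamma} [X G|X G s t u|X G R t|X G p IHp q IHq|X G s p IHp] Y Delta sigma.
- by exists (Bot _).
- apply: expressible_ext (expressible_eq (treal sigma t) (treal sigma u)).
  by move=> N v; rewrite !eval_treal.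
- apply: expressible_ext (@expressible_rel (lang_eq T) Y Delta R
    (fun i => treal sigma (t i))) => N v /=.
  rewrite (_ : (fun i => eval v (treal sigma (t i))) =
    (fun i => eval (M := real_part N) (fun x => eval v (sigma x)) (t i))) //.
  by apply: functional_extensionality_dep => i; rewrite eval_treal.
- exact: expressible_imp (IHp _ _ sigma) (IHq _ _ sigma).
- pose D := ctx_cons (inl s : srt (lang_eq T)) Delta.
  pose tau (o : option X) : term D (inl (ctx_cons s G o) : srt (lang_eq T)) :=
    match o with
    | Some x => tsubst (fun y => Var D (Some y)) (sigma x)
    | None => Var D None
    end.
  apply: expressible_ext (expressible_all1 (IHp _ _ tau)) => N v /=.
  have E (a : N (inl s)) : (fun x => eval (env_cons a v) (tau x)) =
      env_cons (M := real_part N) a (fun x => eval v (sigma x)).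
    by apply: functional_extensionality_dep => -[x|] //=; rewrite eval_tsubst.
  by split=> h a; have := h a; rewrite E.
Qed.

Lemma theory_eq_expressible
    (Q : forall N : structure (lang_eq T), env N (of_void _) -> Prop)
    (N : structure (lang_eq T)) :
  expressible Q -> (forall M, models T M -> Q (struct_eq M) (@env_nil _ _)) ->
  models (theory_eq T) N -> Q N (@env_nil _ _).
Proof.
by case=> sigma hs hQ [_ /(_ sigma) hN]; apply/hs/hN => M /hQ/hs.
Qed.

Lemma struct_eq_models (M : structure (lang T)) :
  models T M -> models (theory_eq T) (struct_eq M).
Proof.
move=> hM; split=> [[s|E]|phi]; last exact.
  by case: hM => /(_ s).
have a i : M (@im_ctx T E i) by case: hM => /(_ (im_ctx i)) /inhabited_witness.
by exists; exists (im_class (E := E) a), a.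
Qed.

End RealPart.

Section Representatives.
Variables (S : signature) (K : rstruct S -> Prop).
Let T := generic_theory K.
Let real : srt (lang_eq T) := inl tt.

Lemma real_part_generic (N : structure (lang_eq T)) :
  models (theory_eq T) N -> satisfies_generic K (real_part N).
Proof.
move=> hN sigma hs.
have [psi hpsi] := @expressible_real T _ _ void (of_void _)
  (fun x : void => match x with end) sigma.
have nilE (M : structure (lang_eq T)) :
    (fun x : void => eval (env_nil M) match x with end) = env_nil (real_part M).
  by apply: functional_extensionality_dep => -[].
rewrite /holds -nilE; apply/hpsi/(proj2 hN) => M hM.
apply/hpsi; rewrite nilE; apply/sat_real_part_struct_eq.
by have := proj2 hM sigma hs; congr sat; apply: functional_extensionality_dep => -[].
Qed.

Definition rep_ar (s : srt (lang_eq T)) : nat :=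
  match s with inl _ => 1 | inr E => im_ar E end.

(** The sorts occurring in an imaginary are elements of [unit] that need not
    reduce to [tt], so real elements must be cast to them. *)
Definition ucast (N : structure (lang_eq T)) (u : unit) :
    N real -> N (inl u : srt (lang_eq T)) :=
  match u with tt => id end.

(** Real sorts are treated as sorts of classes of 1-tuples, so that an element
    of any sort of T^eq is represented by a real tuple. *)
Definition rep (N : structure (lang_eq T)) (s : srt (lang_eq T)) :
    ('I_(rep_ar s) -> N real) -> N s :=
  match s with
  | inl u => fun c => ucast u (c ord0)
  | inr E => fun c => @fun_int (lang_eq T) N (inr E)
                        (fun i => ucast (@im_ctx T E i) (c i))
  end.

Definition tcast (X : Type) (Gamma : X -> srt (lang_eq T)) (u : unit) :
    term Gamma real -> term Gamma (inl u : srt (lang_eq T)) :=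
  match u with tt => id end.

Definition trep (X : Type) (Gamma : X -> srt (lang_eq T)) (s : srt (lang_eq T)) :
    ('I_(rep_ar s) -> term Gamma real) -> term Gamma s :=
  match s with
  | inl u => fun c => tcast u (c ord0)
  | inr E => fun c => @App (lang_eq T) X Gamma (inr E)
                        (fun i => tcast (@im_ctx T E i) (c i))
  end.

Lemma eval_tcast (N : structure (lang_eq T)) (X : Type)
    (Gamma : X -> srt (lang_eq T)) (u : unit) (v : env N Gamma)
    (t : term Gamma real) :
  eval v (tcast u t) = ucast u (eval v t).
Proof. by case: u. Qed.

Lemma eval_trep (N : structure (lang_eq T)) (X : Type)
    (Gamma : X -> srt (lang_eq T)) (s : srt (lang_eq T)) (v : env N Gamma)
    (c : 'I_(rep_ar s) -> term Gamma real) :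
  eval v (trep c) = rep (fun i => eval v (c i)).
Proof.
case: s c => [u|E] c /=; first exact: eval_tcast.
rewrite (_ : (fun i => eval v (tcast (@im_ctx T E i) (c i))) =
  (fun i => ucast (@im_ctx T E i) (eval v (c i)))) //.
by apply: functional_extensionality_dep => i; exact: eval_tcast.
Qed.

(** A sentence that holds in every M^eq by construction, hence in every model of
    T^eq.  The same holds of the next lemma. *)
Lemma rep_surjective (N : structure (lang_eq T)) (s : srt (lang_eq T)) (a : N s) :
  models (theory_eq T) N -> exists c, a = rep c.
Proof.
move=> hN.
pose Q (N : structure (lang_eq T)) (v : env N (of_void _)) :=
  forall a : N s, exists c : 'I_(rep_ar s) -> N real, a = rep c.
suff: Q N (@env_nil _ _) by apply.
apply: theory_eq_expressible hN => [|M hM b] {a}.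
  apply: (expressible_all1 (Q := fun N v =>
    exists c : 'I_(rep_ar s) -> N real, v None = rep c)).
  apply: (expressible_ex (Gamma := ctx_cons s (of_void _)) (Q := fun N v c =>
    v None = rep c)).
  pose D := ctx_cat (ctx_cons s (of_void _)) (fun _ : 'I_(rep_ar s) => real).
  apply: expressible_ext
    (expressible_eq (Var D (inl None)) (trep (fun i => Var D (inr i)))).
  by move=> N0 v; rewrite eval_trep.
case: s b @Q => [[]|E] b _; first by exists (fun=> b).
case: b => C [b Cb] /=; subst C.
pose uncast (u : unit) : M u -> M tt := match u with tt => id end.
exists (fun i => uncast (@im_ctx T E i) (b i)).
have -> : (fun i => ucast (N := struct_eq M) (@im_ctx T E i)
    (uncast (@im_ctx T E i) (b i))) = b; last exact.
by apply: functional_extensionality_dep => i; case: (@im_ctx T E i) (b i).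
Qed.

Lemma rep_kernel (N : structure (lang_eq T)) (E : imaginary T)
    (c c' : 'I_(im_ar E) -> N real) :
  models (theory_eq T) N ->
  rep (s := inr E) c = rep (s := inr E) c' <->
  def_rel (M := real_part N) (im_rel E)
    (fun i => ucast (@im_ctx T E i) (c i)) (fun i => ucast (@im_ctx T E i) (c' i)).
Proof.
move=> hN.
pose Q (N : structure (lang_eq T)) (v : env N (of_void _)) :=
  forall c c' : 'I_(im_ar E) -> N real,
  rep (s := inr E) c = rep (s := inr E) c' <->
  def_rel (M := real_part N) (im_rel E)
    (fun i => ucast (@im_ctx T E i) (c i)) (fun i => ucast (@im_ctx T E i) (c' i)).
suff: Q N (@env_nil _ _) by apply.
apply: theory_eq_expressible hN => [|M hM b b'].
  apply: expressible_all.
  pose C := ctx_cat (of_void (srt (lang_eq T))) (fun _ : 'I_(im_ar E) => real).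
  apply: (expressible_all (Gamma := C) (Q := fun N v c' =>
    rep (s := inr E) (fun i => v (inr i)) = rep (s := inr E) c' <->
    def_rel (M := real_part N) (im_rel E)
      (fun i => ucast (@im_ctx T E i) (v (inr i)))
      (fun i => ucast (@im_ctx T E i) (c' i)))).
  pose D := ctx_cat C (fun _ : 'I_(im_ar E) => real).
  apply: expressible_iff.
    apply: expressible_ext (expressible_eq
      (trep (s := inr E) (fun i => Var D (inl (inr i))))
      (trep (s := inr E) (fun i => Var D (inr i)))).
    by move=> N0 v; rewrite !eval_trep.
  pose sigma (z : 'I_(im_ar E) + 'I_(im_ar E)) :
      term D (inl (ctx_cat (im_ctx (i := E)) (im_ctx (i := E)) z)
        : srt (lang_eq T)) :=
    match z with
    | inl i => tcast (@im_ctx T E i) (Var D (inl (inr i)))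
    | inr i => tcast (@im_ctx T E i) (Var D (inr i))
    end.
  apply: expressible_ext (expressible_real sigma (im_rel E)) => N0 v.
  rewrite /def_rel (_ : (fun x => eval v (sigma x)) =
    env_cat (M := real_part N0) (fun i => ucast (@im_ctx T E i) (v (inl (inr i))))
      (fun i => ucast (@im_ctx T E i) (v (inr i)))) //.
  by apply: functional_extensionality_dep => -[i|i] /=; rewrite eval_tcast.
rewrite /def_rel; have [hr hs ht] := im_equiv E hM.
rewrite sat_real_part_struct_eq.
set a := fun i => ucast _ (b i); set a' := fun i => ucast _ (b' i).
have Eaa : rep (s := inr E) b = rep (s := inr E) b' <->
    im_class (M := M) (E := E) a = im_class a'.
  split=> [/(congr1 sval) //|h].
  have E0 (x y : eq_carrier M (inr E)) : sval x = sval y -> x = y.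
    case: x y => C hC [C' hC'] /= E'; subst C'.
    by congr exist; exact: Prop_irrelevance.
  exact: E0.
rewrite Eaa; split=> [h|h].
  have : im_class a' a' by apply: hr.
  by rewrite -h.
apply/seteqP; split=> x hx; last exact: ht hx.
by apply: ht hx; exact: hs.
Qed.

End Representatives.

(** * Back and forth between models of T^eq *)

Section BackAndForth.
Variables (S : signature) (K : rstruct S -> Prop).
Let T := generic_theory K.
Let real : srt (lang_eq T) := inl tt.

Definition mcast (M : structure (lang_of S)) (u : unit) : M tt -> M u :=
  match u with tt => id end.

Lemma eval_similar (M M' : structure (lang_of S)) (X Y : Type)
    (Gamma : Y -> srt (lang_of S)) (w : X -> M tt) (w' : X -> M' tt)
    (v : env M Gamma) (v' : env M' Gamma) (s : srt (lang_of S))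
    (t : term Gamma s) :
  (forall y, exists x, v y = mcast (Gamma y) (w x) /\
                       v' y = mcast (Gamma y) (w' x)) ->
  exists x, eval v t = mcast s (w x) /\ eval v' t = mcast s (w' x).
Proof. by move=> h; case: t => [y|[]]; exact: h. Qed.

(** Ehrenfeucht-Fraisse: a quantifier is answered by [similar_forth]. *)
Lemma sat_similar (M M' : structure (lang_of S)) (X : finType) (Y : Type)
    (Gamma : Y -> srt (lang_of S)) (phi : formula Gamma)
    (w : X -> M tt) (w' : X -> M' tt) (v : env M Gamma) (v' : env M' Gamma) :
  satisfies_generic K M -> satisfies_generic K M' -> similar w w' ->
  (forall y, exists x, v y = mcast (Gamma y) (w x) /\
                       v' y = mcast (Gamma y) (w' x)) ->
  sat phi v <-> sat phi v'.
Proof.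
move=> gM gM'.
elim: phi X w w' v v'
  => {Y Gamma} [Y G|Y G s t u|Y G R t|Y G p IHp q IHq|Y G s p IHp] X w w' v v' sw h //=.
- have [x [-> ->]] := eval_similar t h.
  have [y [-> ->]] := eval_similar u h.
  by case: s t u => t u; exact: (proj1 sw).
- pose f i := cid (eval_similar (t i) h).
  have := proj2 sw R (fun i => projT1 (f i)).
  rewrite (_ : (fun i => eval v (t i)) = (fun i => w (projT1 (f i)))); last first.
    by apply: functional_extensionality_dep => i; rewrite /f; case: cid => x [].
  rewrite (_ : (fun i => eval v' (t i)) = (fun i => w' (projT1 (f i)))) //.
  by apply: functional_extensionality_dep => i; rewrite /f; case: cid => x [].
- by rewrite (IHp _ _ _ _ _ sw h) (IHq _ _ _ _ _ sw h).
- case: s p IHp => p IHp; split=> hp a.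
    have [a' sa] := similar_forth gM' gM (similar_sym sw) a.
    have sa' := similar_sym sa.
    apply/(IHp _ _ _ (env_cons (a' : M tt) v) _ sa'); last exact: hp.
    case=> [y|]; last by exists None.
    by have [x hx] := h y; exists (Some x).
  have [a' sa] := similar_forth gM gM' sw a.
  apply/(IHp _ _ _ _ (env_cons (a' : M' tt) v') sa); last exact: hp.
  case=> [y|]; last by exists None.
  by have [x hx] := h y; exists (Some x).
Qed.

Variables (N N' : structure (lang_eq T)).
Hypotheses (hN : models (theory_eq T) N) (hN' : models (theory_eq T) N').

Let similar_real (X : Type) (w : X -> N real) (w' : X -> N' real) :=
  similar (M := real_part N) (M' := real_part N') w w'.

(** Equality of imaginary elements is a formula about their representatives. *)
Lemma rep_eq_similar (X : finType) (w : X -> N real) (w' : X -> N' real)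
    (s : srt (lang_eq T)) (c d : 'I_(rep_ar s) -> X) :
  similar_real w w' ->
  rep (fun i => w (c i)) = rep (fun i => w (d i)) <->
  rep (fun i => w' (c i)) = rep (fun i => w' (d i)).
Proof.
case: s c d => [[]|E] c d sw; first exact: (proj1 sw).
rewrite (rep_kernel _ _ hN) (rep_kernel _ _ hN').
apply: (sat_similar _ (real_part_generic hN) (real_part_generic hN') sw).
by case=> i; [exists (c i) | exists (d i)].
Qed.

Lemma eval_rep_similar (X : Type) (w : X -> N real) (w' : X -> N' real)
    (Y : Type) (Gamma : Y -> srt (lang_eq T)) (s : srt (lang_eq T))
    (t : term Gamma s) (v : env N Gamma) (v' : env N' Gamma) :
  (forall y, exists c, v y = rep (fun i => w (c i)) /\
                       v' y = rep (fun i => w' (c i))) ->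
  exists c, eval v t = rep (fun i => w (c i)) /\
            eval v' t = rep (fun i => w' (c i)).
Proof.
move=> h; elim: t => [y|[[]|E] t IH]; first exact: h.
pose f i := cid (IH i).
exists (fun i => projT1 (f i) ord0) => /=; split.
  rewrite (_ : (fun i => eval v (t i)) = (fun i =>
    ucast (@im_ctx T E i) (w (projT1 (f i) ord0)))) //.
  by apply: functional_extensionality_dep => i; rewrite /f; case: cid => x [].
rewrite (_ : (fun i => eval v' (t i)) = (fun i =>
  ucast (@im_ctx T E i) (w' (projT1 (f i) ord0)))) //.
by apply: functional_extensionality_dep => i; rewrite /f; case: cid => x [].
Qed.
End BackAndForth.

(** The truth of a formula about imaginary elements depends only on the pattern
    formed by any real tuples that represent them. *)
Lemma sat_rep_similar (S : signature) (K : rstruct S -> Prop)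
    (N N' : structure (lang_eq (generic_theory K)))
    (X : finType) (w : X -> N (inl tt)) (w' : X -> N' (inl tt)) (Y : Type)
    (Gamma : Y -> srt (lang_eq (generic_theory K))) (phi : formula Gamma)
    (v : env N Gamma) (v' : env N' Gamma) :
  models (theory_eq (generic_theory K)) N ->
  models (theory_eq (generic_theory K)) N' ->
  similar (M := real_part N) (M' := real_part N') w w' ->
  (forall y, exists c, v y = rep (fun i => w (c i)) /\
                       v' y = rep (fun i => w' (c i))) ->
  sat phi v <-> sat phi v'.
Proof.
move=> hN hN'.
(* A quantifier over an imaginary sort is answered by finitely many moves in
   the real parts, one for each entry of a representative. *)
have main (N1 N2 : structure (lang_eq (generic_theory K)))
    (h1 : models (theory_eq (generic_theory K)) N1)
    (h2 : models (theory_eq (generic_theory K)) N2)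
    (X0 : finType) (w1 : X0 -> N1 (inl tt)) (w2 : X0 -> N2 (inl tt))
    (Y0 : Type) (G : Y0 -> srt (lang_eq (generic_theory K)))
    s (v1 : env N1 G) (v2 : env N2 G) :
    similar (M := real_part N1) (M' := real_part N2) w1 w2 ->
    (forall y, exists c, v1 y = rep (fun i => w1 (c i)) /\
                       v2 y = rep (fun i => w2 (c i))) ->
    forall a1 : N1 s, exists a2 : N2 s, exists (X1 : finType)
      (u1 : X1 -> N1 (inl tt)) (u2 : X1 -> N2 (inl tt)),
      similar (M := real_part N1) (M' := real_part N2) u1 u2 /\
      forall y, exists c, env_cons a1 v1 y = rep (fun i => u1 (c i)) /\
                          env_cons a2 v2 y = rep (fun i => u2 (c i)).
  move=> sw h a1; have [c1 ->] := rep_surjective a1 h1.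
  have [c2 sc] := similar_forth_tuple (c1 : _ -> real_part N1 tt)
    (real_part_generic h1) (real_part_generic h2) sw.
  exists (rep c2); eexists; eexists; eexists; split; first exact: sc.
  case=> [y|] /=; last by exists inr.
  by have [c [-> ->]] := h y; exists (fun i => inl (c i)).
elim: phi X w w' v v'
  => {Y Gamma} [Y G|Y G s t u|Y G R t|Y G p IHp q IHq|Y G s p IHp] X w w' v v' sw h //=.
- have [c [-> ->]] := eval_rep_similar t h.
  have [d [-> ->]] := eval_rep_similar u h.
  exact: rep_eq_similar.
- pose f i := cid (eval_rep_similar (t i) h).
  have := proj2 sw R (fun i => projT1 (f i) ord0).
  rewrite (_ : (fun i => eval v (t i)) =
    (fun i => w (projT1 (f i) ord0))); last first.
    by apply: functional_extensionality_dep => i; rewrite /f; case: cid => x [].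
  rewrite (_ : (fun i => eval v' (t i)) = (fun i => w' (projT1 (f i) ord0))) //.
  by apply: functional_extensionality_dep => i; rewrite /f; case: cid => x [].
- by rewrite (IHp _ _ _ _ _ sw h) (IHq _ _ _ _ _ sw h).
- split=> hp a.
    have h' y : exists c, v' y = rep (fun i => w' (c i)) /\
                          v y = rep (fun i => w (c i)).
      by have [c [? ?]] := h y; exists c.
    have [b [X1 [u1 [u2 [su hu]]]]] :=
      main _ _ hN' hN _ _ _ _ _ _ _ _ (similar_sym sw) h' a.
    apply/(IHp _ _ _ (env_cons b v) _ (similar_sym su)); last exact: hp.
    by move=> y; have [c [? ?]] := hu y; exists c.
  have [b [X1 [u1 [u2 [su hu]]]]] := main _ _ hN hN' _ _ _ _ _ _ _ _ sw h a.
  by apply/(IHp _ _ _ _ (env_cons b v') su hu); exact: hp.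
Qed.

(** * Independent elements have independent representatives *)

(** Choose representatives [c] for which the union of all the tuples has the
    largest possible size [u].  If the tuple of [b0] were covered by the others,
    these would already contain [u] points.  Consider the elements [x] such that,
    when [x] replaces [f b0], still no choice of representatives has a union of
    more than [u] points.  This is a first-order condition on [x] over the other
    elements, and it holds of [f b0].  Together with the tuples [c] of the other
    elements, a representative of such an [x] spans at most [u] points, so its
    entries are among the [u] points already there.  Hence there are finitely
    many such [x], and [f b0] is algebraic over the rest. *)
Lemma independent_representatives (S : signature) (K : rstruct S -> Prop)
    (s : srt (lang_eq (generic_theory K)))
    (N : structure (lang_eq (generic_theory K))) (B : {fset nat}) (f : B -> N s) :
  FF (T := theory_eq (generic_theory K)) f ->
  exists c : B * 'I_(rep_ar s) -> N (inl tt),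
    (forall b, f b = rep (fun i => c (b, i))) /\
    (forall b, exists i, forall b' j, b' != b -> c (b, i) <> c (b', j)).
Proof.
set T := generic_theory K; set n := rep_ar s; case=> hN finj fna.
pose U : finType := (B * 'I_n)%type.
pose rep_of (c : U -> N (inl tt)) := forall b, f b = rep (fun i => c (b, i)).
pose large u := exists2 c : U -> N (inl tt), rep_of c &
  exists g : {ffun 'I_u -> U}, injective (fun j => c (g j)).
have [u [c hc [g ginj]] umax] : exists2 u, large u & forall m, large m -> m <= u.
  have ex : exists u, `[< large u >].
    exists 0; apply/asboolP; have hr b := cid (rep_surjective (f b) hN).
    exists (fun k : U => projT1 (hr k.1) k.2) => [b|] /=; first exact: (projT2 (hr b)).
    by exists [ffun j : 'I_0 => False_rect U (notF (valP j))] => -[].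
  have bd u : `[< large u >] -> u <= #|U|.
    move=> /asboolP[c _ [g ginj]]; rewrite -[u]card_ord.
    apply: (@leq_card _ _ (fun j => g j)) => j j' E.
    by apply: ginj; rewrite /= E.
  by case: (ex_maxnP ex bd) => u /asboolP hu umax; exists u => // m /asboolP/umax.
exists c; split=> // b0; apply: contrapT => hno.
have cover i : exists2 k : U, k.1 != b0 & c k = c (b0, i).
  apply: contrapT => h; apply: hno; exists i => b' j hb' E.
  by apply: h; exists (b', j).
(* So the points used by [c] all occur in the tuples other than that of [b0]. *)
have red (k : U) : exists2 k' : U, k'.1 != b0 & c k' = c k.
  have [E|hk] := eqVneq k.1 b0; last by exists k.
  by have [k' h1 h2] := cover k.2; exists k' => //; rewrite h2 -E; case: (k).
pose B0 : {fset nat} := (B `\ val b0)%fset.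
have hB0 : (B0 `<` B)%fset by apply: fproperD1; exact: valP.
apply: (fna B0 hB0).
pose D := ctx_cat (fun _ : B => s) (fun _ : B0 => s).
pose inc (z : B0) : B := fincl (fproper_sub hB0) z.
(* The elements outside [b0] are fixed, and no choice of representatives has a
   union of [u + 1] points. *)
pose Q (M : structure (lang_eq T)) (v : env M D) :=
  (forall z : B0, v (inl (inc z)) = v (inr z)) /\
  forall d : U -> M (inl tt),
    (forall b, v (inl b) = rep (fun i => d (b, i))) ->
    forall h : {ffun 'I_u.+1 -> U},
    ~ forall j j', d (h j) = d (h j') -> j = j'.
have [phi hphi] : expressible Q.
  apply: expressible_and.
    by apply: expressible_finall => z;
       exact: (expressible_eq (Var D (inl (inc z))) (Var D (inr z))).
  apply: (expressible_all (L := lang_eq T) (s := inl tt) (Gamma := D)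
    (Q := fun (M : structure (lang_eq T)) (v : env M D) (d : U -> M (inl tt)) =>
    (forall b, v (inl b) = rep (fun i => d (b, i))) ->
    forall h : {ffun 'I_u.+1 -> U},
    ~ forall j j', d (h j) = d (h j') -> j = j')).
  pose C := ctx_cat D (fun _ : U => inl tt : srt (lang_eq T)).
  apply: expressible_imp.
    apply: expressible_finall => b.
    apply: expressible_ext (expressible_eq (Var C (inl (inl b)))
      (trep (fun i => Var C (inr (b, i))))).
    by move=> M v; rewrite eval_trep.
  apply: expressible_finall => h; apply: expressible_not.
  apply: expressible_finall => j; apply: expressible_finall => j'.
  apply: expressible_imp (expressible_const _ _).
  exact: (expressible_eq (Var C (inr (h j))) (Var C (inr (h j')))).
exists phi.
  apply/hphi; split=> //= d hd h hinj.
  suff : large u.+1 by move/umax; rewrite ltnn.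
  by exists d => //; exists h.
pose F (t : {ffun 'I_n -> U}) (b : B) : N s :=
  if b == b0 then rep (fun i => c (t i)) else f b.
apply: (@sub_finite_set _ _ (F @` [set: {ffun 'I_n -> U}])); last first.
  exact/finite_image/finite_finset.
move=> x /hphi[xE xsmall].
have xf b : b != b0 -> x b = f b.
  move=> nb; have hb : val b \in B0 by rewrite !inE (valP b) andbT.
  have incb : inc [` hb]%fset = b by apply: val_inj.
  have E1 : x (inc [` hb]%fset) = f (inc [` hb]%fset) := xE [` hb]%fset.
  by rewrite incb in E1.
have [c' xc'] := rep_surjective (x b0) hN.
(* A new entry of a representative of [x b0] would give [u + 1] points in total. *)
have img i : exists k, c k = c' i.
  apply: contrapT => hi.
  pose d (k : U) := if k.1 == b0 then c' k.2 else c k.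
  pose h : {ffun 'I_u.+1 -> U} :=
    [ffun j => if unlift ord0 j is Some l then projT1 (cid2 (red (g l)))
               else (b0, i)].
  apply: (xsmall d _ h) => [b|j j'].
    rewrite /d /=; have [->|nb] := eqVneq b b0; first exact: xc'.
    by rewrite xf.
  have dh l : d (projT1 (cid2 (red (g l)))) = c (g l).
    by case: cid2 => k /= /negbTE hk; rewrite /d hk.
  have d0 : d (b0, i) = c' i by rewrite /d /= eqxx.
  rewrite !ffunE; case: unliftP => [l|] ->; case: unliftP => [l'|] ->.
  - by rewrite !dh => /ginj ->.
  - by rewrite dh d0 => E; case: hi; exists (g l).
  - by rewrite dh d0 => E; case: hi; exists (g l').
  - by [].
exists [ffun i => projT1 (cid (img i))] => //; apply: funext => b.
rewrite /F; have [->|nb] := eqVneq b b0; last by rewrite xf.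
rewrite xc'; congr rep; apply: funext => i.
by rewrite ffunE; case: cid.
Qed.

(** * Coding one generic structure in another *)

Section Coding.
Variables (S1 S2 : signature) (K1 : rstruct S1 -> Prop) (K2 : rstruct S2 -> Prop).
Variables (G : rstruct S2) (e : sym S2).
Hypothesis genericG : generic_model K2 G.
Hypothesis movable : forall (X : finType) (w : X -> G) (x0 : X), injective w ->
  infinite_set [set z : G | similar (M := struct_of G) (M' := struct_of G) w
                              (fun x => if x == x0 then z else w x)].
Hypothesis partite : forall (V : finType) (part : V -> 'I_(ar e))
    (Ed : ('I_(ar e) -> V) -> Prop),
  exists2 h : V -> G, injective h & forall v : 'I_(ar e) -> V,
    (forall j, part (v j) = j) -> interp (R := e) (fun j => h (v j)) <-> Ed v.
Variables (R0 : sym S1) (j0 : 'I_(ar e)) (cl : forall R : sym S1, 'I_(ar e) -> 'I_(ar R)).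
Hypothesis cl_surj : forall R i, exists j, cl R j = i.

Let T1 := generic_theory K1.
Let T2 := generic_theory K2.

Lemma struct_of_models : inhabited G -> models T2 (struct_of G).
Proof. by move=> hG; split=> // phi; apply. Qed.

Let G_inhabited : inhabited G.
Proof.
have [h _ _] := @partite 'I_(ar e) id (fun=> True).
exact: (inhabits (h j0)).
Qed.

Let G2 := struct_eq (T := T2) (struct_of G).

Let G2_models : models (theory_eq T2) G2.
Proof. exact/struct_eq_models/struct_of_models. Qed.

(** Equality of [q]-tuples is an equivalence relation, so T^eq has a sort whose
    elements are real tuples: the codes live there. *)
Lemma tuple_imaginary (q : nat) : exists E : imaginary T2, exists Eq : im_ar E = q,
  forall c c' : 'I_(im_ar E) -> G,
    rep (N := G2) (s := inr E) c = rep (N := G2) (s := inr E) c' <-> c = c'.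
Proof.
pose D := ctx_cat (fun _ : 'I_q => tt : srt (lang_of S2)) (fun _ : 'I_q => tt).
have [rel hrel] : expressible (fun M (v : env M D) =>
    forall i, v (inl i) = v (inr i)).
  by apply: expressible_finall => i;
    exact: (expressible_eq (Var D (inl i)) (Var D (inr i))).
have eqv M : models T2 M -> RelationClasses.Equivalence (def_rel (M := M) rel).
  move=> _; split.
  - by move=> a; apply/hrel.
  - by move=> a b /hrel h; apply/hrel => i; exact/esym/h.
  - by move=> a b c /hrel h /hrel h'; apply/hrel => i; exact: etrans (h i) (h' i).
exists (Imaginary eqv), erefl => c c'.
rewrite (rep_kernel _ _ G2_models).
split=> [/hrel h|->]; last exact/hrel.
by apply: funext => i; exact: h i.
Qed.

Section Decode.
Variables (n m : nat).
Let W : finType := ('I_n * (sym S1 * 'I_(ar e)))%type.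
Let X : finType := ('I_m * 'I_n)%type.

(** The pattern of the vertices whose codes are [y]. *)
Definition decode_atom (N : structure (lang_eq T2)) (y : 'I_m * W -> N (inl tt))
    (t : atom S1 X) : Prop :=
  match t with
  | inl kk => forall z, y (kk.1.1, (kk.1.2, z)) = y (kk.2.1, (kk.2.2, z))
  | inr Rv => @rel_int (lang_eq T2) N e (fun j =>
      let k := tagged Rv (cl (tag Rv) j) in y (k.1, (k.2, (tag Rv, j))))
  end.

Definition decode (N : structure (lang_eq T2)) (y : 'I_m * W -> N (inl tt)) :
    {ffun atom S1 X -> bool} :=
  [ffun t => `[< decode_atom y t >]].

Lemma expressible_decode (E : imaginary T2) (Eq : im_ar E = #|W|)
    (P : {ffun atom S1 X -> bool} -> Prop) :
  expressible (L := lang_eq T2) (Gamma := fun _ : 'I_m => inr E)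
   (fun N v => exists y : 'I_m * W -> N (inl tt),
     (forall j, v j = rep (s := inr E) (fun i => y (j, enum_val (cast_ord Eq i)))) /\
     P (decode y)).
Proof.
pose C := fun _ : 'I_m => inr E : srt (lang_eq T2).
apply: (expressible_ex (s := inl tt : srt (lang_eq T2)) (Gamma := C)
  (Q := fun N v (y : 'I_m * W -> N (inl tt)) =>
    (forall j, v j = rep (s := inr E) (fun i => y (j, enum_val (cast_ord Eq i)))) /\
     P (decode y))).
pose D := ctx_cat C (fun _ : 'I_m * W => inl tt : srt (lang_eq T2)).
apply: expressible_and.
  apply: expressible_finall => j.
  apply: expressible_ext (expressible_eq (Var D (inl j))
    (trep (s := inr E) (fun i => Var D (inr (j, enum_val (cast_ord Eq i)))))).
  by move=> N v; rewrite eval_trep.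
apply: (expressible_bool (At := fun t N (v : env N D) =>
  decode_atom (fun y => v (inr y)) t)).
case=> [[k k']|[R v]] /=.
  apply: expressible_finall => z.
  exact: (expressible_eq (Var D (inr (k.1, (k.2, z)))) (Var D (inr (k'.1, (k'.2, z))))).
exact: (@expressible_rel (lang_eq T2) _ D e (fun j =>
  Var D (inr ((v (cl R j)).1, ((v (cl R j)).2, (R, j)))))).
Qed.
End Decode.

(** The points of [G] attached to a vertex are indexed by a symbol and a position
    of an edge of [G].  An edge that codes a relation [R] on [v] meets every
    position once; as [cl R] is onto, all entries of [v] can be read off from it.
    Choosing one index [canon k] for each vertex makes the coding injective. *)
Lemma code_vertices (M : structure (lang_of S1)) (U : finType) (c : U -> M tt) :
  exists (V : finType) (h : V -> G) (loc : U -> sym S1 * 'I_(ar e) -> V),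
  [/\ injective h,
      forall k k' z z', loc k z = loc k' z' <-> c k = c k' /\ z = z' &
      forall (R : sym S1) (v : 'I_(ar R) -> U),
        interp (R := e) (fun j => h (loc (v (cl R j)) (R, j))) <->
        rel_int (L := lang_of S1) (R := R) (fun i => c (v i))].
Proof.
pose canon k : U := odflt k [pick k' | `[< c k' = c k >]].
have c_canon k : c (canon k) = c k.
  by rewrite /canon; case: pickP => //= k' /asboolP.
have canonE k k' : canon k = canon k' <-> c k = c k'.
  split=> [E|E]; first by rewrite -(c_canon k) E c_canon.
  rewrite /canon (@eq_pick _ _ (fun k0 => `[< c k0 = c k' >])).
    by case: pickP => //= /(_ k'); rewrite asboolT.
  by move=> k0 /=; rewrite E.
pose V : finType := (U * (sym S1 * 'I_(ar e)))%type.
pose Ed (u : 'I_(ar e) -> V) := exists R (t : 'I_(ar R) -> U),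
  (forall j, u j = (t (cl R j), (R, j))) /\
  rel_int (L := lang_of S1) (R := R) (fun i => c (t i)).
have [h hinj hE] := partite (fun v : V => v.2.2) Ed.
exists V, h, (fun k z => (canon k, z)); split=> // [k k' z z'|R v].
  by split=> [[/canonE ? ->]|[/canonE -> ->]].
rewrite hE //; split=> [[R' [t [E hR]]]|hR]; last first.
  exists R, (fun i => canon (v i)); split=> //.
  by rewrite (_ : (fun i => _) = (fun i => c (v i))) //; apply: funext.
have ER : R = R' by case: (E j0).
subst R'.
rewrite (_ : (fun i => c (v i)) = (fun i => c (t i))) //.
apply: funext => i; have [j <-] := cl_surj i.
by rewrite -c_canon; case: (E j) => ->.
Qed.

(** A source element is an imaginary, represented by a tuple of vertices; each
    vertex is coded by one point of [G] for every symbol and every position, and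
    the edges of [G] between codes reflect the relations between vertices.
    Since [sat_rep_similar] reduces the source formulas to the pattern of the
    representing tuples, they become definable from the codes.  A representing
    tuple has a vertex of its own, whose code can be moved without changing the
    pattern: this makes the coded tuples algebraically independent. *)
Theorem coding_trile : trile (theory_eq T1) (theory_eq T2).
Proof.
move=> N n s1 phi1; set a1 := rep_ar s1.
pose Z : finType := (sym S1 * 'I_(ar e))%type.
pose W : finType := ('I_a1 * Z)%type.
pose z0 : Z := (R0, j0).
have [E [Eq repE]] := tuple_imaginary #|W|.
pose P i (d : {ffun atom S1 ('I_(n i) * 'I_a1)%type -> bool}) :=
  exists (M : structure (lang_eq T1)) (w : 'I_(n i) * 'I_a1 -> M (inl tt)),
  [/\ models (theory_eq T1) M, diagram (M := real_part M) w = d &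
      sat (phi1 i) (fun j => rep (fun l => w (j, l)))].
pose phi2 i := cid (expressible_decode Eq (P i)).
exists (inr E), (fun i => projT1 (phi2 i)).
move=> A [M [B [f [iso [hFF [isoB isoE]]]]]].
have [hM finj _] := hFF.
have [c [fE cind]] := independent_representatives hFF.
have [V [h [loc [hinj locE hR]]]] := code_vertices (M := real_part M) c.
pose pts (g : V -> G) (b : B) (p : W) : G := g (loc (b, p.1) p.2).
pose tup (g : V -> G) (b : B) : G2 (inr E : srt (lang_eq T2)) :=
  rep (N := G2) (s := inr E) (fun i => pts g b (enum_val (cast_ord Eq i))).
have tupE g g' b b' : tup g b = tup g' b' <-> pts g b = pts g' b'.
  rewrite repE; split=> [H|-> //]; apply: funext => p.
  have := congr1 (fun t => t (cast_ord (esym Eq) (enum_rank p))) H.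
  by rewrite /= cast_ordKV enum_rankK.
exists G2, B, (tup h), iso; split; last first.
  split=> //; split; first by case: isoE.
  move=> i v; rewrite (proj2 isoE i v) /=; set a := iso \o v.
  rewrite (projT2 (phi2 i)).
  pose y (k : 'I_(n i) * W) : G := pts h (a k.1) k.2.
  have ydec : decode (N := G2) y =
      diagram (M := real_part M) (fun k => c (a k.1, k.2)).
    apply/ffunP => t; rewrite !ffunE; apply: asbool_equiv_eq.
    case: t => [[k k']|[R u]] /=; last exact: (hR R (fun i => (a (u i).1, (u i).2))).
    split=> [/(_ z0)/hinj/locE[]//|Ek z].
    by rewrite /y /pts /=; congr h; apply/locE.
  split=> [hs|[y' [yE [M' [w [hM' wE hs]]]]]].
    exists y; split=> //; rewrite ydec; exists M, (fun k => c (a k.1, k.2)).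
    split=> //; move: hs; congr sat.
    by apply: functional_extensionality_dep => j; rewrite /= fE.
  (* The codes are recovered from the imaginary elements, these being tuples. *)
have yy' : y' = y.
    apply: funext => -[j p].
    have /repE H := yE j.
    have := congr1 (fun t => t (cast_ord (esym Eq) (enum_rank p))) H.
    by rewrite /= cast_ordKV enum_rankK.
  move: wE; rewrite yy' ydec => /diagramP sw.
  apply/(sat_rep_similar _ hM' hM sw); last exact: hs.
  by move=> j; exists (fun l => (j, l)); rewrite /= fE.
split=> // [b b'|B0 hB0].
  move=> /tupE H; apply: contrapT => nb; have [i ni] := cind b.
  have /hinj/locE[Ec _] := congr1 (fun t => t (i, z0)) H.
  by apply: (ni b' i) Ec; apply/eqP => /esym.
move=> f0 [phi hphi]; pose inc := fincl (fproper_sub hB0).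
have [b bB0] : exists b : B, forall z : B0, inc z != b.
  have /andP[_ /fsubsetPn[b bB bB0]] := hB0; exists [` bB]%fset => z.
  by apply: contraNneq bB0 => /(congr1 val) /= <-; exact: valP.
have [i ni] := cind b.
(* A code that occurs only in the tuple of [b] can be moved to infinitely many
   places without affecting the other tuples. *)
pose x0 : V := loc (b, i) z0.
pose hz z := fun x => if x == x0 then z else h x.
apply: contra_not (movable (x0 := x0) hinj) => fin.
apply: (@sub_finite_set _ _ ((fun z => tup (hz z) : env G2 (fun _ => inr E))
  @^-1` [set g | sat phi (env_cat g f0)])); last first.
  apply: finite_preimage fin => z z' _ _ H.
  have /tupE H' := congr1 (fun t : env G2 (fun _ => inr E) => t b) H.
  have := congr1 (fun t => t (i, z0)) H'.
  by rewrite /pts /hz /= eqxx.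
move=> z /= sz; apply/(sat_rep_similar _ G2_models G2_models (similar_sym sz)); last exact: hphi.
case=> [b'|z'] /=.
  by exists (fun i => let p := enum_val (cast_ord Eq i) in loc (b', p.1) p.2).
exists (fun i => let p := enum_val (cast_ord Eq i) in loc (inc z', p.1) p.2).
split=> //; rewrite /f0 /=; apply/repE; apply: funext => l; rewrite /hz /=.
case: eqP => // /locE[/esym/ni Ec _]; case: Ec; exact: bB0.
Qed.
End Coding.

(** * Fraisse limits of classes with point amalgamation *)

Lemma finite_enumeration (A : Type) :
  finite_set [set: A] -> exists (X : finType) (f : X -> A), bijective f.
Proof.
case/(@finite_fsetP {classic A}) => F FE.
have hF a : (a : {classic A}) \in F by move/seteqP: FE => [/(_ a I)].
exists F, (fun x => val x); exists (fun a => [` hF a]%fset) => x //.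
exact: val_inj.
Qed.

Lemma finite_bound (X : finType) (w : X -> nat) : exists n, forall x, w x < n.
Proof. by exists (\max_x w x).+1 => x; rewrite ltnS leq_bigmax. Qed.

Lemma injective_unbounded (f : nat -> nat) (n : nat) :
  injective f -> exists j, n <= f j.
Proof.
move=> finj; apply: contrapT => h.
have lt j : f j < n by rewrite ltnNge; apply/negP => hj; apply: h; exists j.
have hi : injective (fun j : 'I_n.+1 => Ordinal (lt j)).
  by move=> j j' /(congr1 val) /= /finj; exact: val_inj.
by have := leq_card _ hi; rewrite !card_ord ltnn.
Qed.

Lemma unbounded_infinite (A : set nat) :
  (forall n, exists2 z, n <= z & A z) -> infinite_set A.
Proof.
move=> h /finite_fsetP[F FE].
have [n hn] := finite_bound (fun x : F => val x).
have [z nz Az] := h n; have zF : z \in F by move: Az; rewrite FE.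
by have := hn [` zF]%fset; rewrite ltnNge nz.
Qed.

Section Fraisse.
Variables (S : signature) (K : rstruct S -> Prop).

Definition interpretation (U : Type) := forall R : sym S, ('I_(ar R) -> U) -> Prop.

(** Amalgamation of [A] with a one-point extension of a subset [F] of [A] in
    which the new point is not identified with a point of [A]. *)
Definition point_amalgamation : Prop :=
  forall (A : rstruct S) (F : Type) (I : interpretation (option F)) (i : F -> A),
  K A -> K (RStruct I) -> injective i ->
  (forall (R : sym S) (v : 'I_(ar R) -> F),
     interp (fun j => i (v j)) <-> I R (fun j => Some (v j))) ->
  exists J : interpretation (option A),
    [/\ K (RStruct J),
        forall (R : sym S) (v : 'I_(ar R) -> A),
          J R (fun j => Some (v j)) <-> interp v &
        forall (R : sym S) (v : 'I_(ar R) -> option F),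
          J R (fun j => omap i (v j)) <-> I R v].

Hypothesis ar_pos : forall R : sym S, 0 < ar R.
Hypothesis K_sub : forall (A B : rstruct S) (h : A -> B), embedding h -> K B -> K A.
Hypothesis K_point : exists (A : rstruct S) (a : A), K A.
Hypothesis K_amalg : point_amalgamation.

Lemma embedding_comp_interp (U : Type) (B : rstruct S) (h : U -> B) :
  injective h ->
  embedding (A := @RStruct S U (fun R v => interp (fun j => h (v j)))) h.
Proof. by move=> hi; split. Qed.

Definition restr (n : nat) (J : interpretation nat) : rstruct S :=
  @RStruct S 'I_n (fun R v => J R (fun j => val (v j))).

(** The one-point extensions over finite tuples, in a countable encoding. *)
Definition task : countType :=
  {m : nat & ({ffun {R : sym S & {ffun 'I_(ar R) -> option 'I_m}} -> bool}
              * m.-tuple nat)%type}.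

Definition task_interp (m : nat)
    (d : {ffun {R : sym S & {ffun 'I_(ar R) -> option 'I_m}} -> bool}) :
    interpretation (option 'I_m) :=
  fun R v => d (Tagged (fun R => {ffun 'I_(ar R) -> option 'I_m}) (finfun v)).

Definition task_valid (n : nat) (J : interpretation nat) (t : task) : Prop :=
  let w := tnth (tagged t).2 in
  [/\ K (RStruct (task_interp (tagged t).1)), forall i, w i < n, injective w &
      forall (R : sym S) (v : 'I_(ar R) -> 'I_(tag t)),
        J R (fun j => w (v j)) <->
        task_interp (tagged t).1 (fun j => Some (v j))].

Definition task_done (n : nat) (J : interpretation nat) (t : task) : Prop :=
  forall (R : sym S) (v : 'I_(ar R) -> option 'I_(tag t)),
    J R (fun j => ocons n (tnth (tagged t).2) (v j)) <->
    task_interp (tagged t).1 v.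

(** A structure on the numbers below [n] is extended by the new point [n], which
    [ocons n i] takes as the value of [None]. *)
Lemma point_extension (n : nat) (J : interpretation nat) (F : Type)
    (I : interpretation (option F)) (i : F -> nat) :
  K (restr n J) -> K (RStruct I) -> injective i -> (forall x, i x < n) ->
  (forall (R : sym S) (v : 'I_(ar R) -> F),
    J R (fun j => i (v j)) <-> I R (fun j => Some (v j))) ->
  exists J' : interpretation nat,
    [/\ K (restr n.+1 J'),
        forall (R : sym S) v, (forall j, v j < n) -> J' R v <-> J R v &
        forall (R : sym S) (v : 'I_(ar R) -> option F),
          J' R (fun j => ocons n i (v j)) <-> I R v].
Proof.
move=> KJ KI iinj ilt iE.
pose i' x : restr n J := Ordinal (ilt x).
have [J' [KJ' J'A J'I]] := K_amalg (i := i') KJ KI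
  (fun x y E => iinj _ _ (congr1 val E)) iE.
exists (fun R v => J' R (fun j => insub (v j))); split=> [|R v vlt|R v].
- pose h (x : 'I_n.+1) : option 'I_n := insub (val x).
  apply: (@K_sub (restr n.+1 (fun R v => J' R (fun j => insub (v j))))
    (RStruct J') h) KJ'; split=> // x y; rewrite /h.
  have top (z : 'I_n.+1) : ~~ (val z < n) -> val z = n.
    by move=> hz; apply/eqP; rewrite eqn_leq -ltnS ltn_ord leqNgt.
  case: insubP => [a _ ax|/top hx]; case: insubP => [b _ bx|/top hy] //.
    by move=> [E]; apply: val_inj; rewrite -ax -bx E.
  by move=> _; apply: val_inj; rewrite hx hy.
- rewrite (_ : (fun j => _) = (fun j => Some (Ordinal (vlt j)))).
    exact: (J'A R (fun j => Ordinal (vlt j))).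
  by apply: funext => j; rewrite (insubT (fun k => k < n) (vlt j)).
- rewrite -J'I.
  rewrite (_ : (fun j => _) = (fun j => omap i' (v j))) //; apply: funext => j.
  case: (v j) => [x|] /=; first by rewrite (insubT (fun k => k < n) (ilt x)).
  by rewrite insubF // ltnn.
Qed.

Lemma stage_extension (n : nat) (J : interpretation nat) (t : option task) :
  K (restr n J) -> exists J' : interpretation nat,
    [/\ K (restr n.+1 J'),
        forall (R : sym S) v, (forall j, v j < n) -> J' R v <-> J R v &
        if t is Some t' then task_valid n J t' -> task_done n J' t' else True].
Proof.
move=> KJ.
have [[t' [tE [h1 h2 h3 h4]]]|none] :=
    pselect (exists t', t = Some t' /\ task_valid n J t').
  have [J' [KJ' J'J J't]] := point_extension KJ h1 h3 h2 h4.
  by exists J'; split=> //; rewrite tE.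
have [A [a KA]] := K_point.
pose h (o : option void) : A := a.
have hinj : injective h by move=> [[]|] [[]|].
have KI := K_sub (embedding_comp_interp hinj) KA.
have noF (R : sym S) (v : 'I_(ar R) -> void) : False by case: (v (Ordinal (ar_pos R))).
have [] := @point_extension n J void _ (fun x => match x with end) KJ KI.
- by case.
- by case.
- by move=> R v; case: (noF R v).
move=> J' [KJ' J'J _]; exists J'; split=> //.
by case: t none => // t none ht; case: none; exists t.
Qed.

Lemma empty_stage : exists J, K (restr 0 J).
Proof.
have [A [a KA]] := K_point; exists (fun R v => True).
apply: (K_sub (h := fun x : restr 0 _ => a)) KA; split; first by case.
by move=> R v; case: (v (Ordinal (ar_pos R))).
Qed.

(** Every task is scheduled infinitely often, once for each first component. *)
Definition scheduled (n : nat) : option task :=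
  omap snd (choice.unpickle n : option (nat * task)%type).

Fixpoint stage (n : nat) : {J | K (restr n J)} :=
  match n with
  | 0 => let: exist J h := cid empty_stage in exist _ J h
  | m.+1 => let: exist J h := stage m in
            let: exist J' h' := cid (stage_extension (scheduled m) h) in
            exist _ J' (let: And3 k _ _ := h' in k)
  end.

Lemma stageS (n : nat) :
  (forall (R : sym S) v, (forall j, v j < n) ->
     sval (stage n.+1) R v <-> sval (stage n) R v) /\
  (forall t, scheduled n = Some t -> task_valid n (sval (stage n)) t ->
     task_done n (sval (stage n.+1)) t).
Proof.
rewrite /=; case: (stage n) => J h /=; case: cid => J' [h1 h2 h3] /=.
by split=> // t E; move: h3; rewrite E.
Qed.

Lemma stage_agree (n m : nat) (R : sym S) (v : 'I_(ar R) -> nat) :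
  n <= m -> (forall j, v j < n) -> sval (stage m) R v <-> sval (stage n) R v.
Proof.
move=> /subnK <- vn; elim: (m - n) => // d IH.
rewrite addSn -IH; apply: (proj1 (stageS _)) => j.
exact: leq_trans (vn j) (leq_addl _ _).
Qed.

Definition limit : rstruct S :=
  @RStruct S nat (fun R v => sval (stage (\max_j v j).+1) R v).

Lemma limit_stage (n : nat) (R : sym S) (v : 'I_(ar R) -> nat) :
  (forall j, v j < n) -> interp (r := limit) v <-> sval (stage n) R v.
Proof.
move=> vn; apply: iff_sym; apply: stage_agree => [|j]; last first.
  by rewrite ltnS leq_bigmax.
have [|j ->] := @eq_bigmax 'I_(ar R) v; first by rewrite card_ord.
exact: vn.
Qed.

Lemma limit_age (A : rstruct S) (h : A -> limit) :
  finite_rstruct A -> embedding h -> K A.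
Proof.
case/finite_enumeration => X [f [f' fK f'K]] [hinj hR].
have [n hn] := finite_bound (fun x => h (f x)).
have {}hn a : h a < n by rewrite -(f'K a).
apply: (@K_sub A (restr n (sval (stage n))) (fun a => Ordinal (hn a))).
  split=> [a b /(congr1 val)/hinj//|R v].
  by apply: iff_trans (hR R v) _; apply: limit_stage => j; exact: hn.
exact: svalP (stage n).
Qed.

(** The extension is realized at each stage at which it is scheduled, always by
    the point added at that stage: hence by arbitrarily large points. *)
Lemma limit_extension (m : nat) (w : 'I_m -> nat) (I : interpretation (option 'I_m))
    (n : nat) :
  injective w -> K (RStruct I) ->
  (forall (R : sym S) (v : 'I_(ar R) -> 'I_m),
    interp (r := limit) (fun j => w (v j)) <-> I R (fun j => Some (v j))) ->
  exists2 z, n <= z & forall (R : sym S) (v : 'I_(ar R) -> option 'I_m),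
    interp (r := limit) (fun j => ocons z w (v j)) <-> I R v.
Proof.
move=> winj KI wI.
pose d := [ffun t : {R : sym S & {ffun 'I_(ar R) -> option 'I_m}} =>
  `[< I (tag t) (tagged t) >]].
have dI : task_interp d = I.
  apply: functional_extensionality_dep => R; apply: funext => v.
  apply: propext; rewrite /task_interp ffunE /= asboolE.
  by rewrite (_ : (finfun v : _ -> _) = v) //; apply: funext => j; rewrite ffunE.
pose t : task := Tagged (fun m => ({ffun {R : sym S & {ffun 'I_(ar R) -> option 'I_m}}
  -> bool} * m.-tuple nat)%type) (d, [tuple w i | i < m]).
have wE : tnth (tagged t).2 = w by apply: funext => i; rewrite /= tnth_mktuple.
have [b wb] := finite_bound w.
have pinj : injective (fun j : nat => choice.pickle (j, t)).
  by move=> j j' /(pcan_inj choice.pickleK) [].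
have [j] := injective_unbounded (maxn n b) pinj.
set z := choice.pickle (j, t) => jn.
have [nz bz] : n <= z /\ b <= z by move: jn; rewrite geq_max => /andP.
exists z => // R v.
have wz i : w i < z by exact: leq_trans (wb i) bz.
have valid : task_valid z (sval (stage z)) t.
  rewrite /task_valid wE dI; split=> // R' v'.
  by rewrite -wI; apply: iff_sym; apply: limit_stage => k; exact: wz.
have sched : scheduled z = Some t by rewrite /scheduled choice.pickleK.
have := (proj2 (stageS z)) t sched valid R v; rewrite wE dI => <-.
apply: (@limit_stage z.+1) => k; case: (v k) => [i|] //=.
exact: ltnW (wz i).
Qed.

Let sim (X : Type) (w w' : X -> nat) :=
  similar (M := struct_of limit) (M' := struct_of limit) w w'.

Let sim_reindex (X Y : Type) (w w' : X -> nat) (h : Y -> X) (u u' : Y -> nat) :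
  (forall y, u y = w (h y)) -> (forall y, u' y = w' (h y)) -> sim w w' -> sim u u'.
Proof.
exact: (@similar_reindex S X Y (struct_of limit) (struct_of limit) w w' h u u').
Qed.

(** [w] may repeat values, so the extension property is applied to an
    irredundant enumeration [s] of its range. *)
Lemma limit_forth_new (X : finType) (w w' : X -> nat) (a n : nat) :
  sim w w' -> (forall x, w x != a) ->
  exists2 a', n <= a' & sim (ocons a w) (ocons a' w').
Proof.
move=> sw wa.
pose s := undup [seq w x | x : X].
have idxP x : w x \in s by rewrite mem_undup; apply: map_f; rewrite mem_enum.
pose idx x : 'I_(size s) := Ordinal (etrans (index_mem _ _) (idxP x)).
have pre (i : 'I_(size s)) : exists x, w x = nth 0 s i.
  have : nth 0 s i \in s by exact: mem_nth.
  by rewrite {2}/s mem_undup => /mapP[x _ ->]; exists x.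
pose p i := sval (cid (pre i)).
have wp i : w (p i) = nth 0 s i by rewrite /p; case: cid.
have wpinj : injective (fun i => w (p i)).
  move=> i j; rewrite !wp => /eqP; rewrite nth_uniq ?undup_uniq // => /eqP.
  exact: val_inj.
have wpidx x : w (p (idx x)) = w x by rewrite wp /= nth_index.
have w'pinj : injective (fun i => w' (p i)) by move=> i j /(proj1 sw)/wpinj.
have oinj : injective (ocons a (fun i => w (p i))).
  move=> [i|] [j|] //=; first by move/wpinj => ->.
    by move/eqP; rewrite (negbTE (wa _)).
  by move/esym/eqP; rewrite (negbTE (wa _)).
pose I : interpretation (option 'I_(size s)) := fun R v =>
  interp (r := limit) (fun j => ocons a (fun i => w (p i)) (v j)).
have KI : K (RStruct I).
  apply: limit_age (embedding_comp_interp (B := limit) oinj).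
  exact: finite_finset.
have [b w'b] := finite_bound w'.
have [a' a'n a'E] := limit_extension (maxn n b) w'pinj KI
  (fun R v => iff_sym (proj2 sw R (fun j => p (v j)))).
move: a'n; rewrite geq_max => /andP[na' ba'].
have w'a' x : w' x != a' by rewrite ltn_eqF // (leq_trans (w'b x)).
exists a' => //.
apply: (sim_reindex (w := ocons a (fun i => w (p i)))
  (w' := ocons a' (fun i => w' (p i))) (h := omap idx)).
- by case=> [x|] //=; rewrite wpidx.
- by case=> [x|] //=; apply/(proj1 sw); rewrite wpidx.
split=> [i j|R v]; last exact: (iff_sym (a'E R v)).
split=> [/oinj -> //|].
case: i j => [i|] [j|] //=; first by move/w'pinj => ->.
  by move/eqP; rewrite (negbTE (w'a' _)).
by move/esym/eqP; rewrite (negbTE (w'a' _)).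
Qed.

Lemma limit_forth (X : finType) (w w' : X -> nat) (a : nat) :
  sim w w' -> exists a', sim (ocons a w) (ocons a' w').
Proof.
move=> sw; have [[x xa]|none] := pselect (exists x, w x = a).
  exists (w' x); apply: (sim_reindex (h := ocons x id) _ _ sw);
  by case=> [y|] //=.
have [|a' _ sa] := limit_forth_new 0 sw (a := a); last by exists a'.
by move=> x; apply/eqP => xa; apply: none; exists x.
Qed.

(** Extend the tuple of the points other than [w x0] by infinitely many points of
    the same pattern. *)
Lemma limit_moves (X : finType) (w : X -> nat) (x0 : X) : injective w ->
  infinite_set [set z : nat | sim w (fun x => if x == x0 then z else w x)].
Proof.
move=> winj; apply: unbounded_infinite => n.
pose Y : finType := {x : X | x != x0}.
pose wY (y : Y) := w (val y).
have sY : sim wY wY by split.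
have [|z nz sz] := limit_forth_new n sY (a := w x0).
  by case=> y hy; rewrite /wY /= (inj_eq winj).
exists z => //.
pose h x : option Y := insub x.
by apply: (sim_reindex (h := h) _ _ sz) => x; rewrite /h;
  case: insubP => [y hx yx|/negbNE/eqP ->];
  rewrite /= ?eqxx // /wY yx // (negbTE hx).
Qed.

Definition pairs_sim (p : seq (nat * nat)) : Prop :=
  sim (fun k : seq_sub p => (val k).1) (fun k => (val k).2).

Lemma pairs_sim_cons (p : seq (nat * nat)) (a a' : nat) :
  sim (ocons a (fun k : seq_sub p => (val k).1))
      (ocons a' (fun k : seq_sub p => (val k).2)) ->
  pairs_sim ((a, a') :: p).
Proof.
move=> sa; pose h (k : seq_sub ((a, a') :: p)) : option (seq_sub p) :=
  insub (val k).
apply: (sim_reindex (h := h) _ _ sa) => -[k hk]; rewrite /h /=;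
  case: insubP => [y _ /= -> //|/= hn];
  by move: hk; rewrite inE (negbTE hn) orbF => /eqP ->.
Qed.

Lemma pairs_sim_step (p : seq (nat * nat)) (n : nat) : pairs_sim p ->
  exists p', [/\ pairs_sim p', {subset p <= p'},
    exists a, (n, a) \in p' & exists b, (b, n) \in p'].
Proof.
move=> sp; have [a /pairs_sim_cons sa] := limit_forth n sp.
have [b sb] := limit_forth n (similar_sym sa).
exists ((b, n) :: (n, a) :: p); split.
- exact/pairs_sim_cons/similar_sym.
- by move=> k hk; rewrite !inE hk !orbT.
- by exists a; rewrite !inE eqxx orbT.
- by exists b; rewrite !inE eqxx.
Qed.

(** The union of a back-and-forth chain starting from [p]. *)
Lemma pairs_sim_automorphism (p : seq (nat * nat)) : pairs_sim p ->
  exists2 g : limit -> limit, isomorphism g & forall k, k \in p -> g k.1 = k.2.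
Proof.
move=> sp.
pose next n (q : {q | pairs_sim q}) : {q | pairs_sim q} :=
  let: exist q' h := cid (pairs_sim_step n (svalP q)) in
  exist _ q' (let: And4 k _ _ _ := h in k).
have nextP n q : [/\ {subset sval q <= sval (next n q)},
    exists a, (n, a) \in sval (next n q) & exists b, (b, n) \in sval (next n q)].
  by rewrite /next; case: cid => q' [].
pose fix chain n := if n is m.+1 then next m (chain m) else exist _ p sp.
have mono n m : n <= m -> {subset sval (chain n) <= sval (chain m)}.
  move=> /subnK <-; elim: (m - n) => // d IH k /IH hk.
  by case: (nextP (d + n) (chain (d + n))) => H _ _; exact: H.
have tot n : {a | (n, a) \in sval (chain n.+1)}.
  by apply: cid; case: (nextP n (chain n)).
have tot' n : {b | (b, n) \in sval (chain n.+1)}.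
  by apply: cid; case: (nextP n (chain n)).
have eqs n m k l : k \in sval (chain n) -> l \in sval (chain m) ->
    k.1 = l.1 <-> k.2 = l.2.
  move=> /(mono n (maxn n m)) hk /(mono m (maxn n m)) hl.
  have {}hk := hk (leq_maxl _ _); have {}hl := hl (leq_maxr _ _).
  exact: (proj1 (svalP (chain (maxn n m))) (SeqSub hk) (SeqSub hl)).
exists (fun n => sval (tot n)); last first.
  move=> k hk; have /= := eqs _ 0 (k.1, sval (tot k.1)) k (svalP (tot k.1)) hk.
  by case=> /(_ erefl).
have gE n k : k \in sval (chain n) -> sval (tot k.1) = k.2.
  by move=> hk; case: (eqs _ _ (_, _) k (svalP (tot k.1)) hk) => /(_ erefl).
have g'E n k : k \in sval (chain n) -> sval (tot' k.2) = k.1.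
  by move=> hk; case: (eqs _ _ (_, _) k (svalP (tot' k.2)) hk) => _ /(_ erefl).
have gK : cancel (fun n => sval (tot n)) (fun n => sval (tot' n)).
  by move=> n; exact: (g'E _ _ (svalP (tot n))).
split; first by exists (fun n => sval (tot' n)) => // n;
  exact: (gE _ _ (svalP (tot' n))).
split=> [|R v]; first exact: can_inj gK.
have [b vb] := finite_bound v.
have hv j : (v j, sval (tot (v j))) \in sval (chain b).
  exact: mono (vb j) _ (svalP (tot (v j))).
exact: (proj2 (svalP (chain b)) R (fun j => SeqSub (hv j))).
Qed.

Lemma limit_homogeneous (A : rstruct S) (h1 h2 : A -> limit) :
  finite_rstruct A -> embedding h1 -> embedding h2 ->
  exists2 g : limit -> limit, isomorphism g & g \o h1 = h2.
Proof.
case/finite_enumeration => X [f [f' fK f'K]] [i1 e1] [i2 e2].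
pose p := [seq (h1 (f x), h2 (f x)) | x : X].
have [|g ig gE] := @pairs_sim_automorphism p.
  have pre (k : seq_sub p) : exists x, val k = (h1 (f x), h2 (f x)).
    by case: k => k /= /mapP[x _ ->]; exists x.
  pose a (k : seq_sub p) : A := f (sval (cid (pre k))).
  have aE k : val k = (h1 (a k), h2 (a k)) by rewrite /a; case: cid.
  apply: (sim_reindex (h := a) (w := h1) (w' := h2)).
  - by move=> k; rewrite aE.
  - by move=> k; rewrite aE.
  - split=> [x y|R v]; first by split=> [/i1|/i2] ->.
    exact: iff_trans (iff_sym (e1 R v)) (e2 R v).
exists g => //; apply: funext => a /=.
rewrite -(f'K a); apply: (gE (h1 (f (f' a)), h2 (f (f' a)))).
by apply: map_f; rewrite mem_enum.
Qed.

Lemma limit_universal (A : rstruct S) :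
  finite_rstruct A -> K A -> exists h : A -> limit, embedding h.
Proof.
move=> /finite_enumeration[X [f [f' fK f'K]]] KA.
have main (m : nat) (I : interpretation 'I_m) : K (RStruct I) ->
    exists h : RStruct I -> limit, embedding h.
  elim: m I => [|m IH] I KI.
    exists (fun=> 0); split=> [[]//|R v].
    by case: (v (Ordinal (ar_pos R))).
  have linj : injective (lift (@ord0 m)) by exact: lift_inj.
  have oinj : injective (ocons (@ord0 m) (lift ord0)).
    by move=> [i|] [j|] //= /linj ->.
  have [w [winj wE]] := IH _ (K_sub (embedding_comp_interp (B := RStruct I) linj) KI).
  have [b wb] := finite_bound w.
  have [z bz zE] := limit_extension b winj
    (K_sub (embedding_comp_interp (B := RStruct I) oinj) KI)
    (fun R v => iff_sym (wE R v)).
  exists (fun k => ocons z w (unlift ord0 k)); split.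
    have wz i : w i != z by rewrite ltn_eqF // (leq_trans (wb i)).
    move=> k l; case: (unliftP ord0 k) => [i|] ->; case: (unliftP ord0 l) => [j|] -> //=.
    - by move/winj => ->.
    - by move/eqP; rewrite (negbTE (wz i)).
    - by move/esym/eqP; rewrite (negbTE (wz j)).
  move=> R v; apply: iff_sym.
  apply: iff_trans (zE R (fun j => unlift ord0 (v j))) _ => /=.
  rewrite (_ : (fun j => ocons _ _ _) = v) //; apply: funext => j.
  by case: unliftP => [i|] ->.
have cinj : injective (fun i : 'I_#|X| => f (enum_val i)).
  by move=> i j /(can_inj fK)/enum_val_inj.
have [h [hinj hE]] := main _ _ (K_sub (embedding_comp_interp cinj) KA).
exists (fun a => h (enum_rank (f' a))); split.
  by move=> a b /hinj/enum_rank_inj/(can_inj f'K).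
move=> R v; apply: iff_trans (hE R (fun j => enum_rank (f' (v j)))) => /=.
rewrite (_ : (fun j => f _) = v) //; apply: funext => j.
by rewrite enum_rankK f'K.
Qed.

(** The limit has, besides the defining properties of a generic model, trivial
    algebraic closure: any point of a finite tuple can be moved to infinitely
    many places over the other points. *)
Theorem fraisse : exists2 G : rstruct S, generic_model K G &
  forall (X : finType) (w : X -> G) (x0 : X), injective w ->
  infinite_set [set z : G | similar (M := struct_of G) (M' := struct_of G) w
                              (fun x => if x == x0 then z else w x)].
Proof.
exists limit; last exact: limit_moves.
split; [exact: countableP | move=> A finA | exact: limit_homogeneous].
split; first exact: limit_universal.
by case=> h; exact: limit_age.
Qed.

End Fraisse.

(** * Hypergraphs and their order expansions *)

Section Codable.
Variables (S : signature) (K : rstruct S -> Prop) (e : sym S).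

(** Each hypergraph on [V] whose edges meet every part once, the parts being
    indexed by the positions of the symbol [e], is found inside [K].  Relations
    between vertices that do not form a transversal are left open: in this form
    the property passes to order expansions. *)
Definition embeds_partite : Prop :=
  forall (V : finType) (part : V -> 'I_(ar e)) (Ed : ('I_(ar e) -> V) -> Prop),
  exists2 I : interpretation S V, K (RStruct I) &
    forall v : 'I_(ar e) -> V, (forall j, part (v j) = j) -> I e v <-> Ed v.

Definition hereditary : Prop :=
  forall (A B : rstruct S) (h : A -> B), embedding h -> K B -> K A.

Definition codable : Prop := [/\ hereditary, point_amalgamation K & embeds_partite].

End Codable.

Lemma surjection_ord (m n : nat) : 0 < n <= m ->
  exists f : 'I_m -> 'I_n, forall i, exists j, f j = i.
Proof.
case/andP=> n0 nm; exists (fun j => insubd (Ordinal n0) (val j)) => i.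
exists (widen_ord nm i); apply: val_inj.
by rewrite val_insubd /= ltn_ord.
Qed.

(** The Fraisse limit of [K2] is the target of the coding; a source symbol of
    smaller arity than [e] has its first entry at several positions of an edge. *)
Theorem codable_trile (S1 S2 : signature) (K1 : rstruct S1 -> Prop)
    (K2 : rstruct S2 -> Prop) (R0 : sym S1) (e : sym S2) :
  (forall R : sym S1, 0 < ar R <= ar e) -> (forall R : sym S2, 0 < ar R) ->
  codable K2 e ->
  trile (theory_eq (generic_theory K1)) (theory_eq (generic_theory K2)).
Proof.
move=> ar1 ar2 [hK aK pK]; pose j0 : 'I_(ar e) := Ordinal (ar2 e).
have K_point : exists (A : rstruct S2) (a : A), K2 A.
  by have [I KI _] := pK _ (@id 'I_(ar e)) (fun=> True); exists (RStruct I), j0.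
have [G gG mG] := fraisse ar2 hK K_point aK.
pose cl R := cid (surjection_ord (ar1 R)).
apply: (coding_trile gG mG _ R0 j0 (cl := fun R => sval (cl R))) => [V part Ed|R];
  last exact: svalP (cl R).
have [I KI IE] := pK V part Ed.
have [_ age _] := gG.
have [h [hinj hE]] := proj1 (age (RStruct I) finite_finset) KI.
by exists h => // v /IE <-; exact: iff_sym (hE e v).
Qed.

Lemma finite_rstruct_embedding (S : signature) (A B : rstruct S) (h : A -> B) :
  embedding h -> finite_rstruct B -> finite_rstruct A.
Proof.
by move=> [hinj _]; apply: (finite_preimage (f := h)) => x y _ _; exact: hinj.
Qed.

Section FreeAmalgam.
Variables (S : signature) (A : rstruct S) (F : Type).
Variables (I : interpretation S (option F)) (i : F -> A).
Hypotheses (iinj : injective i)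
  (iE : forall (R : sym S) (v : 'I_(ar R) -> F),
     interp (fun j => i (v j)) <-> I (fun j => Some (v j))).

(** The amalgam with the fewest relations: a tuple that meets both the new point
    and [A] outside [F] satisfies none. *)
Definition free_amalgam : interpretation S (option A) := fun R v =>
  (exists2 u : 'I_(ar R) -> A, v = (fun j => Some (u j)) & interp u) \/
  (exists2 u : 'I_(ar R) -> option F, v = (fun j => omap i (u j)) & I u).

Lemma omap_inj : injective (omap i).
Proof. by move=> [x|] [y|] //= [/iinj ->]. Qed.

Lemma free_amalgam_old (R : sym S) (v : 'I_(ar R) -> A) :
  free_amalgam (fun j => Some (v j)) <-> interp v.
Proof.
split=> [|h]; last by left; exists v.
case=> [[u E hu]|[u E hu]].
  rewrite (_ : v = u) //; apply: funext => j.
  by case: (congr1 (fun t => t j) E).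
have hj j : exists x, u j = Some x /\ v j = i x.
  by have /= := congr1 (fun t => t j) E; case: (u j) => //= x [->]; exists x.
pose x j := sval (cid (hj j)).
have xE j : u j = Some (x j) /\ v j = i (x j) := svalP (cid (hj j)).
rewrite (_ : v = fun j => i (x j)); last by apply: funext => j; case: (xE j).
by apply/iE; move: hu; congr I; apply: funext => j; case: (xE j).
Qed.

Lemma free_amalgam_new (R : sym S) (v : 'I_(ar R) -> option F) :
  free_amalgam (fun j => omap i (v j)) <-> I v.
Proof.
split=> [|h]; last by right; exists v.
case=> [[u E hu]|[u E hu]]; last first.
  rewrite (_ : v = u) //; apply: funext => j; apply: omap_inj.
  exact: (congr1 (fun t => t j) E).
have hj j : exists x, v j = Some x /\ u j = i x.
  by have /= := congr1 (fun t => t j) E; case: (v j) => //= x [<-]; exists x.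
pose x j := sval (cid (hj j)).
have xE j : v j = Some (x j) /\ u j = i (x j) := svalP (cid (hj j)).
rewrite (_ : v = fun j => Some (x j)); last by apply: funext => j; case: (xE j).
by apply/iE; move: hu; congr interp; apply: funext => j; case: (xE j).
Qed.

End FreeAmalgam.

Section Hypergraphs.
Variables (r k : nat) (hr : 2 <= r) (hk : r < k).

Lemma HH_hereditary : hereditary (HH r).
Proof.
move=> A B h hh [finB irr symm]; have [hinj hE] := hh.
split=> [|v /(hE tt v)/irr hv|v p /(hE tt v)/symm hv]; last exact/(hE tt (v \o p))/hv.
  exact: finite_rstruct_embedding hh finB.
by move=> x y /(congr1 h)/hv.
Qed.

Lemma HHex_hereditary : hereditary (HHex r k).
Proof.
move=> A B h hh [hB exB]; split; first exact: HH_hereditary hh hB.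
move=> w winj; have [|e einj ne] := exB (h \o w).
  by apply: inj_comp; [exact: (proj1 hh) | exact: winj].
by exists e => //; apply: contra_not ne => /(proj2 hh tt).
Qed.

Lemma HH_free_amalgam (A : rstruct (hyper_sig r)) (F : Type)
    (I : interpretation (hyper_sig r) (option F)) (i : F -> A) :
  HH r A -> HH r (RStruct I) -> injective i -> HH r (RStruct (free_amalgam I i)).
Proof.
move=> [finA irrA symA] [_ irrI symI] iinj; split.
- have [X [f [f' fK f'K]]] := finite_enumeration finA.
  rewrite /finite_rstruct (_ : [set: _] = (omap f : option X -> option A) @` [set: option X]).
    exact/finite_image/finite_finset.
  apply/seteqP; split=> // -[a|] _; last by exists None.
  by exists (Some (f' a)); rewrite //= f'K.
- move=> v [[u -> hu]|[u -> hu]] x y; first by move=> [/(irrA _ hu)].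
  by move/(omap_inj iinj)/(irrI _ hu).
- move=> v p [[u -> hu]|[u -> hu]].
    by left; exists (u \o p) => //; exact: symA.
  by right; exists (u \o p) => //; exact: symI.
Qed.

Lemma HH_amalgamation : point_amalgamation (HH r).
Proof.
move=> A F I i hA hI iinj iE; exists (free_amalgam I i); split.
- exact: HH_free_amalgam.
- by move=> R v; apply: free_amalgam_old.
- by move=> R v; apply: free_amalgam_new.
Qed.

(** Two vertices of a complete hypergraph lie in a common edge, as [r >= 2]. *)
Lemma injection_through (a b : 'I_k) : a != b ->
  exists2 e : 'I_r -> 'I_k, injective e & exists x y, e x = a /\ e y = b.
Proof.
move=> ab; have rk : r <= k by exact: ltnW.
have r0 : 0 < r by exact: leq_trans hr.
pose x : 'I_r := Ordinal r0; pose y : 'I_r := Ordinal hr.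
pose wd := widen_ord rk.
pose p := tperm (wd x) a.
have pa : p (wd x) = a by rewrite tpermL.
pose b' := p b.
have pb' : p b' = b by rewrite tpermK.
have b'x : b' != wd x by apply: contra_neq ab => E; rewrite -pa -E pb'.
exists (fun j => p (tperm (wd y) b' (wd j))).
  move=> j j' /perm_inj/perm_inj /(congr1 val) /= E; exact: val_inj.
exists x, y; split; last by rewrite tpermL.
by rewrite tpermD.
Qed.

Lemma HHex_amalgamation : point_amalgamation (HHex r k).
Proof.
move=> A F I i [hA exA] [hI exI] iinj iE; exists (free_amalgam I i).
split; [|by move=> R v; apply: free_amalgam_old|by move=> R v; apply: free_amalgam_new].
split; first exact: HH_free_amalgam.
move=> w winj; apply: contrapT => clique.
have {}clique e : injective e -> free_amalgam (R := tt) I i (w \o e).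
  by move=> einj; apply: contrapT => ne; apply: clique; exists e.
have [[t wt]|none] := pselect (exists t, w t = None).
  (* Every vertex of a clique through the new point lies in an edge with it, so
     the clique lies in the one-point extension of [F]. *)
  have im s : exists x, w s = omap i x.
    have [->|ts] := eqVneq s t; first by exists None.
    have [e einj [x [y [ex ey]]]] := injection_through ts.
    have [[u E _]|[u E _]] := clique e einj.
      by have := congr1 (fun f => f y) E; rewrite /= ey wt.
    by have := congr1 (fun f => f x) E; rewrite /= ex => ->; exists (u x).
  pose w' s := sval (cid (im s)).
  have w'E s : w s = omap i (w' s) := svalP (cid (im s)).
  have [|e einj ne] := exI w'.
    by move=> s s' E; apply: winj; rewrite !w'E E.
  apply: ne; apply/(free_amalgam_new (i := i) iinj iE); have := clique e einj.
  by congr free_amalgam; apply: funext => j; rewrite /= w'E.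
have im s : exists a, w s = Some a.
  by case E: (w s) => [a|]; [exists a | case: none; exists s].
pose w' s := sval (cid (im s)).
have w'E s : w s = Some (w' s) := svalP (cid (im s)).
have [|e einj ne] := exA w'.
  by move=> s s' E; apply: winj; rewrite !w'E E.
apply: ne; apply/(free_amalgam_old (I := I) (i := i) iE); have := clique e einj.
by congr free_amalgam; apply: funext => j; rewrite /= w'E.
Qed.

Section Partite.
Variables (V : finType) (part : V -> 'I_r) (Ed : ('I_r -> V) -> Prop).

(** The closure of [Ed] under permutations: [u] is the reordering of [v] by
    parts. *)
Definition partite_interp : interpretation (hyper_sig r) V :=
  fun _ v => injective (part \o v) /\
    exists u, [/\ forall j, part (u j) = j, forall j, exists l, u j = v l & Ed u].

Lemma partite_interpE (v : 'I_r -> V) :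
  (forall j, part (v j) = j) -> partite_interp (R := tt) v <-> Ed v.
Proof.
move=> vE; split=> [[_ [u [uE uv hu]]]|hv]; last first.
  split; last by exists v; split=> // j; exists j.
  by move=> j j'; rewrite /= !vE.
rewrite (_ : v = u) //; apply: funext => j.
have [l ul] := uv j.
by rewrite ul; congr v; rewrite -(vE l) -ul uE.
Qed.

Lemma partite_HH : HH r (RStruct partite_interp).
Proof.
split; first exact: finite_finset.
  by move=> v [vinj _] x y E; apply: vinj; rewrite /= E.
move=> v p [vinj [u [uE uv hu]]]; split.
  exact: (inj_comp vinj (@perm_inj _ p)).
exists u; split=> // j; have [l ->] := uv j.
by exists ((p^-1)%g l); rewrite /= permKV.
Qed.

Lemma partite_HHex : HHex r k (RStruct partite_interp).
Proof.
split=> [|w winj]; first exact: partite_HH.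
(* Two of the [k > r] vertices lie in the same part. *)
have [a [b [ab E]]] : exists a b, a != b /\ part (w a) = part (w b).
  apply: contrapT => h.
  have pinj : injective (part \o w).
    by move=> a b E; apply/eqP; apply: contrapT => /negP ab; apply: h; exists a, b.
  by have := leq_card _ pinj; rewrite !card_ord leqNgt hk.
have [e einj [x [y [ex ey]]]] := injection_through ab.
exists e => // -[/(_ x y) /=]; rewrite ex ey => /(_ E) xy.
by move: ab; rewrite -ex -ey xy eqxx.
Qed.
End Partite.

Lemma HH_codable : codable (HH r) (tt : sym (hyper_sig r)).
Proof.
split; [exact: HH_hereditary | exact: HH_amalgamation|].
move=> V part Ed; exists (partite_interp part Ed); first exact: partite_HH.
exact: partite_interpE.
Qed.

Lemma HHex_codable : codable (HHex r k) (tt : sym (hyper_sig r)).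
Proof.
split; [exact: HHex_hereditary | exact: HHex_amalgamation|].
move=> V part Ed; exists (partite_interp part Ed); first exact: partite_HHex.
exact: partite_interpE.
Qed.

End Hypergraphs.

Section OrderExpansion.
Variables (S : signature) (K : rstruct S -> Prop).

Lemma order_relE (A : rstruct (order_sig S)) (v : 'I_2 -> A) :
  interp (r := A) (R := None) v <-> order_rel (v ord0) (v ord_max).
Proof.
rewrite /order_rel (_ : (fun i => _) = v) //; apply: funext => i.
have [->//|ni] := eqVneq i ord0; congr v; apply: val_inj.
by case: i ni => [[|[|]]].
Qed.

Lemma order_exp_hereditary : hereditary K -> hereditary (order_exp K).
Proof.
move=> hK A B h [hinj hE] [KB [irr trs] tot].
have relE a b : order_rel a b <-> order_rel (h a) (h b).
  by rewrite {1}/order_rel hE order_relE.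
split.
- by apply: (hK (order_reduct A) (order_reduct B) h) KB; split=> // R v; exact: (hE (Some R) v).
- split=> [a /relE /irr //|a b c /relE ab /relE bc].
  exact/relE/trs/bc.
- move=> a b; have [/relE|/hinj|/relE] := tot (h a) (h b); last by constructor 3.
    by constructor 1.
  by constructor 2.
Qed.

Definition expand (U : Type) (I : interpretation S U) (lt : U -> U -> Prop) :
    interpretation (order_sig S) U :=
  fun R => match R return ('I_(ar (s := order_sig S) R) -> U) -> Prop with
           | Some R0 => I R0
           | None => fun v => lt (v ord0) (v ord_max)
           end.

Lemma order_exp_expand (U : Type) (I : interpretation S U) (lt : U -> U -> Prop) :
  K (RStruct I) -> RelationClasses.StrictOrder lt ->
  (forall a b, [\/ lt a b, a = b | lt b a]) ->
  order_exp K (RStruct (expand I lt)).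
Proof. by []. Qed.

(** The amalgam of the reducts is ordered by extending the cut that the new point
    makes in [F] to a cut in [A]. *)
Lemma order_exp_amalgamation :
  point_amalgamation K -> point_amalgamation (order_exp K).
Proof.
move=> aK A F I i [KA [irrA trsA] totA] [KI [irrI trsI] totI] iinj iE.
have [J0 [KJ0 J0A J0I]] := aK (order_reduct A) F (fun R => I (Some R)) i KA KI iinj
  (fun R v => iE (Some R) v).
pose ltA : A -> A -> Prop := @order_rel S A.
pose ltI : option F -> option F -> Prop := @order_rel S (RStruct I).
have iltE x y : ltA (i x) (i y) <-> ltI (Some x) (Some y).
  pose v (j : 'I_2) := if j == ord0 then x else y.
  apply: iff_trans (iff_sym (order_relE (fun j => i (v j)))) _.
  exact: iff_trans (iE None v) (order_relE (A := RStruct I) (fun j => Some (v j))).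
(* The lower part of the cut is generated by the points of [F] below the new
   point. *)
pose below a := exists2 x, ltI (Some x) None & a = i x \/ ltA a (i x).
pose lt (a b : option A) := match a, b with
  | Some a, Some b => ltA a b
  | Some a, None => below a
  | None, Some b => ~ below b
  | None, None => False end.
have down a b : ltA a b -> below b -> below a.
  move=> ab [x hx bx]; exists x => //; right.
  by case: bx => [<-//|bx]; exact: trsA bx.
have belowE x : below (i x) <-> ltI (Some x) None.
  split=> [[y hy]|hx]; last by exists x => //; left.
  by case=> [/iinj ->//|/iltE xy]; exact: trsI hy.
exists (expand J0 lt); split.
- apply: order_exp_expand => //.
    split; first by case=> [a|] //; exact: irrA.
    case=> [a|] [b|] [c|] //=.
    + exact: trsA.
    + exact: down.
    + move=> ba nc; have [//|E|ca] := totA a c; case: nc; first by rewrite -E.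
      exact: down ba.
    + by move=> nb bc bc'; apply: nb; exact: down bc'.
  case=> [a|] [b|] /=; last by constructor 2.
  + by have [?|->|?] := totA a b; [constructor 1|constructor 2|constructor 3].
  + by have [?|?] := pselect (below a); [constructor 1|constructor 3].
  + by have [?|?] := pselect (below b); [constructor 3|constructor 1].
- by case=> [R|] v; [exact: J0A|exact: iff_sym (order_relE v)].
- case=> [R|] v; first exact: J0I.
  apply: iff_trans (iff_sym (order_relE (A := RStruct I) v)).
  rewrite /= -/ltI.
  case: (v ord0) => [x|]; case: (v ord_max) => [y|] /=.
  + exact: iltE.
  + exact: belowE.
  + rewrite belowE; split=> [ny|ly yl]; last exact: irrI (trsI _ _ _ ly yl).
    by have [|//|] := totI None (Some y).
  + by split=> // /irrI.
Qed.

Lemma order_exp_codable (e : sym S) :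
  codable K e -> codable (order_exp K) (Some e : sym (order_sig S)).
Proof.
move=> [hK aK pK]; split.
- exact: order_exp_hereditary.
- exact: order_exp_amalgamation.
move=> V part Ed; have [I KI IE] := pK V part Ed.
pose lt (a b : V) : Prop := enum_rank a < enum_rank b.
exists (expand I lt); last exact: IE.
apply: order_exp_expand => //; first split.
- by move=> a; rewrite /lt /RelationClasses.complement ltnn.
- by move=> a b c; exact: ltn_trans.
move=> a b; rewrite /lt; case: ltngtP => E.
- by constructor 1.
- by constructor 3.
- by constructor 2; apply/enum_rank_inj/val_inj.
Qed.

End OrderExpansion.

Lemma trile_trans (T1 T2 T3 : theory) : trile T1 T2 -> trile T2 T3 -> trile T1 T3.
Proof.
move=> h12 h23 N n s1 phi1; have [s2 [phi2 h2]] := h12 N n s1 phi1.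
have [s3 [phi3 h3]] := h23 N n s2 phi2.
by exists s3, phi3 => A /h2/h3.
Qed.

Lemma CC_eq (S1 S2 : signature) (K1 : rstruct S1 -> Prop) (K2 : rstruct S2 -> Prop) :
  trile (theory_eq (generic_theory K1)) (theory_eq (generic_theory K2)) ->
  trile (theory_eq (generic_theory K2)) (theory_eq (generic_theory K1)) ->
  CC K1 = CC K2.
Proof.
move=> h12 h21; apply: funext => T; apply: propext.
by split=> -[hT h]; split=> //; apply: trile_trans h.
Qed.

Theorem theorem4p20 (r k : nat) (hr : 2 <= r) (hk : r < k) :
  [/\ CC (HH r) = CC (order_exp (HH r)),
      CC (order_exp (HH r)) = CC (HHex r k) &
      CC (HHex r k) = CC (order_exp (HHex r k))].
Proof.
have r0 : 0 < r by exact: leq_trans hr.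
have c1 := HH_codable r.
have c2 := HHex_codable hr hk.
have arH (R : sym (hyper_sig r)) : 0 < ar R <= r by rewrite /= r0 leqnn.
have arO (R : sym (order_sig (hyper_sig r))) : 0 < ar R <= r.
  by case: R => [R|] /=; rewrite ?r0 ?leqnn.
have posH (R : sym (hyper_sig r)) : 0 < ar R by case/andP: (arH R).
have posO (R : sym (order_sig (hyper_sig r))) : 0 < ar R by case/andP: (arO R).
pose eH : sym (hyper_sig r) := tt.
pose eO : sym (order_sig (hyper_sig r)) := Some eH.
split; apply: CC_eq.
- exact: (codable_trile (e := eO) eH arH posO (order_exp_codable c1)).
- exact: (codable_trile (e := eH) eO arO posH c1).
- exact: (codable_trile (e := eH) eO arO posH c2).
- exact: (codable_trile (e := eO) eH arH posO (order_exp_codable c1)).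
- exact: (codable_trile (e := eO) eH arH posO (order_exp_codable c2)).
- exact: (codable_trile (e := eH) eO arO posH c2).
Qed.
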